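(* Let $G$ be a finite graph and let $\mathcal{S}$ be a scale on $G$. The Cheeger constant of $G$ at scale $\mathcal{S}$ can be computed in polynomial time with respect to the size of $G$. That is, there is an algorithm that, given a finite graph $G=(V,E)$ and a scale $\mathcal{S}=\{S_i\}_{i\in V}$ on $G$ (with at least one nonempty set), outputs $\gamma(G,\mathcal{S})$ in time polynomial in the size of $G$ (the numbers of its vertices and edges), regardless of the choice of $\mathcal{S}$.
   Context: A graph $G=(V,E)$ is oriented, with $E\subset V\times V$ and no self-loops. A scale on $G$ is a family $\mathcal{S}=\{S_i\}_{i\in V}$ of subsets of $V$, one per vertex. For $T\subset V$ the edge boundary is $\partial T=\big((T\times(V\setminus T))\cup((V\setminus T)\times T)\big)\cap E$. The Cheeger constant of $G$ at scale $\mathcal{S}$ is $$\gamma(G,\mathcal{S})=\min\left\{\frac{|\partial T|}{|T|}: T\neq\emptyset,\ T\subset S\text{ for some }S\in\mathcal{S}\right\}.$$ *)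

(* Defs.v *)
From mathcomp Require Import all_boot all_order all_algebra.

Set Implicit Arguments.
Unset Strict Implicit.
Unset Printing Implicit Defensive.

Import Order.TTheory GRing.Theory Num.Theory.

Local Open Scope ring_scope.

Record graph := Graph {
  vertex :> finType;
  edges : {set vertex * vertex};
  no_loops : forall x, (x, x) \notin edges
}.

Definition graph_size (G : graph) : nat := (#|G| + #|edges G|)%N.

Definition scale (G : graph) := G -> {set G}.

Definition boundary (G : graph) (T : {set G}) : {set G * G} :=
  (setX T (~: T) :|: setX (~: T) T) :&: edges G.

Definition boundary_ratio (G : graph) (T : {set G}) : rat :=
  #|boundary T|%:R / #|T|%:R.

Definition admissible (G : graph) (S : scale G) (T : {set G}) : bool :=
  (T != set0) && [exists i, T \subset S i].

(* The value 0 is a dummy one: the minimum is over an empty family exactly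
   when all the sets of the scale are empty. *)
Definition cheeger (G : graph) (S : scale G) : rat :=
  if [pick T | admissible S T] is Some T0 then
    boundary_ratio [arg min_(T < T0 | admissible S T) boundary_ratio T]%O
  else 0.

(* Random access machines in the style of Cook and Reckhow, over the natural
   numbers (so subtraction is truncated), with the logarithmic cost criterion.
   The input is a read-only, randomly accessible finite sequence. *)
Inductive instr :=
| IConst of nat & nat       (* X_i <- c *)
| IAdd of nat & nat & nat   (* X_i <- X_j + X_k *)
| ISub of nat & nat & nat   (* X_i <- X_j - X_k *)
| ILoad of nat & nat        (* X_i <- X_(X_j) *)
| IStore of nat & nat       (* X_(X_i) <- X_j *)
| IRead of nat & nat        (* X_i <- the input item of index X_j *)
| IJump of nat & nat        (* if X_i > 0, go to instruction l *)
| IHalt.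

Definition memory := nat -> nat.

Definition upd (m : memory) (i v : nat) : memory :=
  fun j => if j == i then v else m j.

Definition step (inp : seq nat) (ins : instr) (pc : nat) (m : memory) :
    nat * memory :=
  match ins with
  | IConst i c => (pc.+1, upd m i c)
  | IAdd i j k => (pc.+1, upd m i (m j + m k)%N)
  | ISub i j k => (pc.+1, upd m i (m j - m k)%N)
  | ILoad i j => (pc.+1, upd m i (m (m j)))
  | IStore i j => (pc.+1, upd m (m i) (m j))
  | IRead i j => (pc.+1, upd m i (nth 0%N inp (m j)))
  | IJump i l => (if (0 < m i)%N then l else pc.+1, m)
  | IHalt => (pc, m)
  end.

(* The number of binary digits of n, and 1 for n = 0. *)
Definition len (n : nat) : nat := (trunc_log 2 n).+1.

Definition cost (inp : seq nat) (ins : instr) (m : memory) : nat :=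
  match ins with
  | IConst _ c => len c
  | IAdd _ j k | ISub _ j k => len (m j) + len (m k)
  | ILoad _ j => len (m j) + len (m (m j))
  | IStore i j => len (m i) + len (m j)
  | IRead _ j => len (m j) + len (nth 0%N inp (m j))
  | IJump i _ => len (m i)
  | IHalt => 1
  end%N.

(* [exec A inp pc m t m'] : started at instruction pc with memory m, the
   program A halts with memory m' after a total time t. *)
Inductive exec (A : seq instr) (inp : seq nat) :
    nat -> memory -> nat -> memory -> Prop :=
| ExecHalt pc m :
    nth IHalt A pc = IHalt -> exec A inp pc m (cost inp IHalt m) m
| ExecStep pc m t m' ins :
    nth IHalt A pc = ins -> ins <> IHalt ->
    exec A inp (step inp ins pc m).1 (step inp ins pc m).2 t m' ->
    exec A inp pc m (cost inp ins m + t)%N m'.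

(* A rational number is output as a fraction X_0 / X_1 of natural numbers. *)
Definition outputs (A : seq instr) (inp : seq nat) (r : rat) (t : nat) : Prop :=
  exists m : memory,
    [/\ exec A inp 0 (fun=> 0%N) t m, (0 < m 1)%N & r = (m 0)%:R / (m 1)%:R].

(* The number of vertices, then the adjacency matrix, then the matrix of the
   scale, whose row of index x is the indicator of S x, both by rows. *)
Definition encode (G : graph) (S : scale G) : seq nat :=
  #|G| :: [seq nat_of_bool ((x, y) \in edges G) | x <- enum G, y <- enum G]
       ++ [seq nat_of_bool (y \in S x) | x <- enum G, y <- enum G].

(* Main.v *)
Require Import Defs.
From mathcomp Require Import all_boot all_order all_algebra.
From mathcomp Require Import zify.
From Stdlib Require Import FunctionalExtensionality.

Set Implicit Arguments.
Unset Strict Implicit.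
Unset Printing Implicit Defensive.

Import Order.TTheory GRing.Theory Num.Theory.

(** The Cheeger constant is a minimum of fractions whose numerator is at most
    [n ^ 2] and whose denominator is at most [n], where [n] is the number of
    vertices. Let [num / den] be this minimum. A walk that starts from [0 / 1],
    increments the numerator of the current fraction when it is below
    [num / den] and the denominator when it is above never leaves the box
    [0..num] x [0..den], hence it reaches [num / den] after at most
    [num + den] steps ([walk_step_inv], [walk_correct]). So it is enough to
    compare a fraction [p / q] with the Cheeger constant in polynomial time,
    that is, to find the sign of the maximum of [p * #|T| - q * #|boundary T|]
    over the nonempty subsets [T] of the sets of the scale.

    This is a minimum cut problem. Its numbers are so small that a naive
    balancing of loads solves it. Put [P] units of load on each vertex of
    [S i] and give each edge the capacity [Q] in both directions; as long as
    the load of some [x] exceeds the load of [y] by at least 2 and the edge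
    from [x] to [y] is not saturated, move one unit from [x] to [y]. The unit
    vanishes if [y] is outside [S i]. Each move decreases the sum of the
    squares of the loads, which is polynomial, so the moves end soon. At the
    end the load that remains in [S i] is the maximum of
    [P * #|T| - Q * #|boundary T|] over [T \subset S i], up to an error of
    [n ^ 2] ([load_lower_bound], [load_upper_bound]): the load of [T] can
    leave it only through its boundary; conversely, some integer in [0..n] is
    not the load of any vertex, and all the edges that leave the set [T] of
    the vertices above this level are saturated. Taking [P = M * p + e] and
    [Q = M * q] with large [e] and much larger [M] makes the three possible
    signs of the maximum visible on the total load ([load_above],
    [load_equal], [load_below]).

    The machine program is written in a language of bounded loops with one
    array, whose semantics is a total function, and compiled ([simulation]).
    Its cost needs no invariant about the computed values. Registers grow only
    by increments, so they are bounded by the input and the number of steps,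
    and each loop is capped by a register that it does not modify, so the
    number of steps is bounded by the text of the program ([bounded_sem],
    [steps_static]). The price of this is that sums and products are computed
    by counting. *)

(** * Balanced loads *)

Section Balance.
Context (V : finType) (w : V -> V -> nat) (S : {set V}) (P Q : nat).
Hypothesis w_sym : forall x y, w x y = w y x.

Definition cut (T : {set V}) := \sum_(x in T) \sum_(y in ~: T) w x y.

(** [l] is the load and [r] the residual capacity. The net flow from [x] to [y]
    is [Q * w x y - r x y]; the last clause is its conservation at [x], where
    the terms are arranged so that no subtraction of naturals occurs. *)
Definition flow_state (l : V -> nat) (r : V -> V -> nat) :=
  [/\ forall x, x \notin S -> l x = 0,
      forall x y, x != y -> r x y + r y x = (Q * w x y).*2
    & forall x, x \in S -> l x + \sum_(y | y != x) Q * w x y = P + \sum_(y | y != x) r x y].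

Definition stable (l : V -> nat) (r : V -> V -> nat) :=
  forall x y, x != y -> 0 < r x y -> l x <= (l y).+1.

(** Summing the conservation law over [T], the flows inside [T] cancel in
    pairs, which leaves the flow through the boundary. *)
Lemma flow_cut l r (T : {set V}) : flow_state l r -> T \subset S ->
  \sum_(x in T) l x + Q * cut T = P * #|T| + \sum_(x in T) \sum_(y in ~: T) r x y.
Proof.
move=> [_ hr hS] /subsetP hT.
have split_sum (f : V -> V -> nat) : \sum_(x in T) \sum_(y | y != x) f x y =
    \sum_(x in T) \sum_(y in T | y != x) f x y + \sum_(x in T) \sum_(y in ~: T) f x y.
  rewrite -big_split /=; apply: eq_bigr => x xT.
  rewrite (bigID (mem T)) /=; congr (_ + _); apply: eq_bigl => y.
    by rewrite andbC.
  by rewrite inE; case: eqP => // ->; rewrite xT.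
have twice (f : V -> V -> nat) : (\sum_(x in T) \sum_(y in T | y != x) f x y).*2 =
    \sum_(x in T) \sum_(y in T | y != x) (f x y + f y x).
  under [RHS]eq_bigr => x _ do rewrite big_split /=.
  rewrite big_split /= -addnn; congr (_ + _).
  rewrite (exchange_big_dep (mem T)) /=; last by move=> x y _ /andP[].
  by apply: eq_bigr => y yT; apply: eq_bigl => x; rewrite yT eq_sym.
have inner : \sum_(x in T) \sum_(y in T | y != x) r x y =
    \sum_(x in T) \sum_(y in T | y != x) Q * w x y.
  apply: double_inj; rewrite !twice; apply: eq_bigr => x _.
  apply: eq_bigr => y /andP[_ hxy]; rewrite hr 1?eq_sym //.
  by rewrite (w_sym y x) addnn.
have : \sum_(x in T) (l x + \sum_(y | y != x) Q * w x y) =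
    \sum_(x in T) (P + \sum_(y | y != x) r x y).
  by apply: eq_bigr => x xT; apply: hS; apply: hT.
rewrite !big_split /= !split_sum inner.
rewrite sum_nat_const /cut big_distrr /=.
under [X in _ -> _ + X = _]eq_bigr do rewrite big_distrr /=.
by rewrite (mulnC P); lia.
Qed.

Lemma load_lower_bound l r (T : {set V}) : flow_state l r -> T \subset S ->
  P * #|T| <= Q * cut T + \sum_x l x.
Proof.
move=> hf hT; have := flow_cut hf hT.
rewrite [\sum_x l x](bigID (mem T)) /=; lia.
Qed.

(** Pigeonhole: [#|V|] vertices cannot occupy [#|V| + 1] levels. *)
Lemma missing_level (l : V -> nat) : exists2 k, k <= #|V| & forall x, l x != k.
Proof.
have : ~~ [forall k : 'I_#|V|.+1, [exists x, l x == k]].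
  apply/negP => /forallP h.
  pose g (k : 'I_#|V|.+1) := xchoose (existsP (h k)).
  have gK k : l (g k) = k by apply/eqP/(xchooseP (existsP (h k))).
  have : injective g by move=> k1 k2 e; apply: val_inj; rewrite /= -!gK e.
  by move=> /leq_card; rewrite card_ord ltnn.
rewrite negb_forall => /existsP[k]; rewrite negb_exists => /forallP h.
by exists k => //; rewrite -ltnS.
Qed.

(** In a stable state an unsaturated edge descends at most one level. Hence
    nothing more can flow out of the vertices above an empty level [k <= #|V|],
    and the other vertices carry less than [#|V|] each. *)
Lemma load_upper_bound l r : flow_state l r -> stable l r ->
  exists2 T : {set V}, T \subset S &
    \sum_x l x + Q * cut T <= P * #|T| + #|V| * #|V|.
Proof.
move=> hf hs; have [k hk hl] := missing_level l.
pose T := [set x | k < l x].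
have hT : T \subset S.
  apply/subsetP => x; rewrite inE => hx; apply: contraTT hx => hx.
  by have [-> //] := hf.
exists T => //.
have saturated : \sum_(x in T) \sum_(y in ~: T) r x y = 0.
  apply: big1 => x; rewrite inE => hx; apply: big1 => y; rewrite !inE => hy.
  apply/eqP; rewrite -leqn0 leqNgt; apply/negP => hr.
  have xy : x != y by apply: contraNneq hy => <-.
  by have := hs x y xy hr; have := hl y; lia.
have := flow_cut hf hT; rewrite saturated.
have : \sum_(x in ~: T) l x <= #|V| * #|V|.
  apply: leq_trans (_ : \sum_(x in ~: T) #|V| <= _).
    by apply: leq_sum => x; rewrite !inE; lia.
  by rewrite sum_nat_const leq_mul2r max_card orbT.
rewrite [\sum_x l x](bigID (mem T)) /=.
have -> : \sum_(x | x \notin T) l x = \sum_(x in ~: T) l x.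
  by apply: eq_bigl => x; rewrite in_setC.
lia.
Qed.

(** Moving one unit from [x] to [y]; a vertex outside [S] absorbs it. The effect
    is stated pointwise, which does not tie it to an encoding of the state. *)
Definition pushed (l l' : V -> nat) (r r' : V -> V -> nat) x y :=
  [/\ l' x = (l x).-1, l' y = l y + (y \in S),
      forall z, z != x -> z != y -> l' z = l z
    & [/\ r' x y = (r x y).-1, r' y x = (r y x).+1
      & forall u v, u != v -> (u, v) != (x, y) -> (u, v) != (y, x) -> r' u v = r u v]].

Lemma pushed_flow l l' r r' x y : x != y -> 0 < r x y -> (l y).+1 < l x ->
  flow_state l r -> pushed l l' r r' x y -> flow_state l' r'.
Proof.
move=> xy hr hl [f1 f2 f3] [p1 p2 p3 [q1 q2 q3]].
have xS : x \in S by apply: contraLR hl => /f1 ->.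
have rest u : u != x -> u != y -> forall v, v != u -> r' u v = r u v.
  by move=> ux uy v vu; apply: q3; rewrite ?xpair_eqE ?negb_and ?ux ?uy // eq_sym.
split.
- move=> z zS; have [zx|zx] := eqVneq z x; first by rewrite -zx (negPf zS) in xS.
  have [zy|zy] := eqVneq z y; last by rewrite p3 ?f1.
  by rewrite zy p2 -zy (negPf zS) f1.
- move=> u v uv.
  have [[-> ->]|n1] := eqVneq (u, v) (x, y).
    by have := f2 x y xy; rewrite q1 q2; lia.
  have [[-> ->]|n2] := eqVneq (u, v) (y, x).
    by have := f2 y x; rewrite eq_sym => /(_ xy); rewrite q1 q2; lia.
  rewrite !q3 ?f2 //; first by rewrite eq_sym.
    by move: n2; rewrite !xpair_eqE andbC.
  by move: n1; rewrite !xpair_eqE andbC.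
- move=> z zS; have := f3 z zS.
  have [->|zx] := eqVneq z x.
    rewrite p1 [in X in _ = _ + X -> _](bigD1 y) 1?eq_sym //=.
    rewrite [in X in _ -> _ = _ + X](bigD1 y) 1?eq_sym //= q1.
    rewrite (eq_bigr (F1 := fun v => r' x v) (r x)); last first.
      move=> v /andP[vx vy]; apply: q3; first by rewrite eq_sym.
        by rewrite xpair_eqE (negPf vy) andbF.
      by rewrite xpair_eqE (negPf xy).
    by lia.
  have [zy|zy] := eqVneq z y.
    rewrite zy in zS *; rewrite p2 zS addn1.
    rewrite [in X in _ = _ + X -> _](bigD1 x) //=.
    rewrite [in X in _ -> _ = _ + X](bigD1 x) //= q2.
    rewrite (eq_bigr (F1 := fun v => r' y v) (r y)); last first.
      move=> v /andP[vy vx]; apply: q3; first by rewrite eq_sym.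
        by rewrite xpair_eqE [y == x]eq_sym (negPf xy).
      by rewrite xpair_eqE (negPf vx) andbF.
    by lia.
  by rewrite p3 // => ->; congr (_ + _); apply: eq_bigr => v vz; rewrite rest.
Qed.

(** The integer inequality [(a - 1) ^ 2 + (b + 1) ^ 2 < a ^ 2 + b ^ 2] holds
    exactly when [b + 1 < a]. *)
Lemma pushed_energy l l' r r' x y : x != y -> (l y).+1 < l x ->
  pushed l l' r r' x y -> \sum_z l' z ^ 2 < \sum_z l z ^ 2.
Proof.
move=> xy hl [p1 p2 p3 _].
rewrite (bigD1 x) //= (bigD1 y) 1?eq_sym //= [X in _ < X](bigD1 x) //=.
rewrite [X in _ < _ + X](bigD1 y) 1?eq_sym //= p1 p2.
rewrite (eq_bigr (F1 := fun z => l' z ^ 2) (fun z => l z ^ 2)); last first.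
  by move=> z /andP[zx zy]; rewrite p3.
case: (y \in S); nia.
Qed.

End Balance.

(** * Comparing a fraction with the Cheeger constant *)

(** Both orientations of an edge cross the boundary, so the flow problem is on
    the symmetric multigraph. *)
Definition edge_weight (G : graph) (x y : G) : nat :=
  ((x, y) \in edges G) + ((y, x) \in edges G).

Lemma edge_weight_sym (G : graph) (x y : G) : edge_weight x y = edge_weight y x.
Proof. exact: addnC. Qed.

Lemma card_boundary (G : graph) (T : {set G}) :
  #|boundary T| = cut (@edge_weight G) T.
Proof.
have cardX (A B : {set G}) :
    #|setX A B :&: edges G| = \sum_(x in A) \sum_(y in B) ((x, y) \in edges G).
  rewrite -sum1_card pair_big /= [RHS]big_mkcond /= [LHS]big_mkcond /=.
  apply: eq_bigr => -[x y] _; rewrite !inE /=.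
  by case: (x \in A); case: (y \in B); case: ((x, y) \in edges G).
rewrite /boundary setIUl cardsU.
rewrite (_ : _ :&: (_ :&: _) = set0); last first.
  by apply/setP=> -[x y]; rewrite !inE /=; case: (x \in T); case: (y \in T); rewrite /= ?andbF.
rewrite cards0 subn0 !cardX [X in _ + X]exchange_big /= -big_split /=.
by apply: eq_bigr => x _; rewrite -big_split.
Qed.

Lemma cheeger_attained (G : graph) (S : scale G) : (exists i, S i != set0) ->
  exists T0 i0, [/\ T0 != set0, T0 \subset S i0,
    cheeger S = boundary_ratio T0 &
    forall i (T : {set G}), T \subset S i -> T != set0 ->
      #|boundary T0| * #|T| <= #|boundary T| * #|T0| ].
Proof.
move=> [i hi]; rewrite /cheeger; case: pickP => [T1 hT1|/(_ (S i))]; last first.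
  by rewrite /admissible hi /= => /existsP[]; exists i.
case: Order.TotalTheory.arg_minP => // T0 /andP[T0n /existsP[i0 T0S]] hmin.
exists T0, i0; split=> // j T TS Tn.
have := hmin T; rewrite /admissible Tn /= => /(_ _)/wrap[].
  by apply/existsP; exists j.
rewrite /boundary_ratio ler_pdivrMr ?ltr0n ?card_gt0 // mulrAC.
by rewrite ler_pdivlMr ?ltr0n ?card_gt0 // -!natrM ler_nat.
Qed.

(** The loads of all the sources [i] are added up before they are compared with
    the thresholds [e] and [M]. These exceed the errors: [e > n * n ^ 2] and
    [M > n * (e * n + n ^ 2)]. *)
Section Threshold.
Context (G : graph) (S : scale G) (p q a b : nat).
Let n := #|G|.
Let e := n.+1 ^ 3.
Let M := n.+1 ^ 6.
Let w := @edge_weight G.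
Context (l : G -> G -> nat) (r : G -> G -> G -> nat).
Hypothesis hflow : forall i, flow_state w (S i) (M * p + e) (M * q) (l i) (r i).
Hypothesis hstable : forall i, stable (l i) (r i).
Context (T0 : {set G}) (i0 : G).
Hypotheses (T0n : T0 != set0) (T0S : T0 \subset S i0).
Hypothesis hopt : forall i (T : {set G}), T \subset S i -> T != set0 ->
  cut w T0 * #|T| <= cut w T * #|T0|.

Let L := \sum_i \sum_x l i x.
Let T0gt0 : 0 < #|T0|. Proof. by rewrite card_gt0. Qed.

(* An optimal set alone forces this total load. *)
Let lower : (M * p + e) * #|T0| <= M * q * cut w T0 + L.
Proof.
apply: leq_trans (load_lower_bound (@edge_weight_sym G) (hflow i0) T0S) _.
by rewrite leq_add2l /L [X in _ <= X](bigD1 i0) //= leq_addr.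
Qed.

(* Each source is bounded through the set that its balanced state exhibits. *)
Let per_source K : (forall i (T : {set G}), T \subset S i ->
    \sum_x l i x + M * q * cut w T <= (M * p + e) * #|T| + n * n ->
    \sum_x l i x <= K) -> L <= n * K.
Proof.
move=> H; apply: leq_trans (_ : \sum_(i : G) K <= _); last by rewrite sum_nat_const.
apply: leq_sum => i _.
by have [T TS hT] := load_upper_bound (@edge_weight_sym G) (hflow i) (@hstable i); apply: (H i T).
Qed.

Let n_gt0 : 0 < n. Proof. by apply/card_gt0P; exists i0. Qed.

Let M_large : n * (e * n + n * n) < M.
Proof.
rewrite /M /e !expnS expn0; nia.
Qed.
Let e_large : n * (n * n) < e.
Proof. rewrite /e !expnS expn0; nia. Qed.

Lemma load_above : q * cut w T0 < p * #|T0| -> M <= L.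
Proof. move=> h; have := lower; have := T0gt0; nia. Qed.

(** At equality [P * #|T| - Q * cut w T] is at most [e * #|T|] for all [T], and
    it is [e * #|T0|] for the optimal [T0]. *)
Lemma load_equal : q * cut w T0 = p * #|T0| -> e <= L < M.
Proof.
move=> h; apply/andP; split; first by have := lower; have := T0gt0; nia.
apply: leq_ltn_trans M_large; apply: per_source => i T TS hT.
have hTn : #|T| <= n by apply: max_card.
suff : p * #|T| <= q * cut w T by nia.
have [->|Tn] := eqVneq T set0; first by rewrite cards0 muln0.
by rewrite -(leq_pmul2r T0gt0); have := hopt TS Tn; nia.
Qed.

(** Here [p * #|T| - q * cut w T] is at most [-1] for nonempty [T], and the
    factor [M] turns this into a deficit that no error can compensate; so the
    set that bounds the load from above is empty. *)
Lemma load_below : p * #|T0| < q * cut w T0 -> L < e.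
Proof.
move=> h; apply: leq_ltn_trans e_large; apply: per_source => i T TS hT.
have hTn : #|T| <= n by apply: max_card.
have [T_0|Tn] := eqVneq T set0; first by rewrite T_0 cards0 muln0 in hT; lia.
have cT : 0 < #|T| by rewrite card_gt0.
have hlt : p * #|T| < q * cut w T.
  by rewrite -(ltn_pmul2r T0gt0); have := hopt TS Tn; nia.
have : M * (p * #|T|).+1 <= M * (q * cut w T) by rewrite leq_mul2l hlt orbT.
have : e * #|T| <= n * (e * n) by rewrite mulnC; nia.
have := M_large; nia.
Qed.

End Threshold.

(** * A language of bounded loops *)

(** [Loop x b c] runs [c] as many times as the smaller of the initial values of
    [x] and [b]. The cap [b] is what makes the running time readable from the
    text of a command. *)
Inductive cmd :=
| Zero of nat
| Inc of nat
| Minus of nat & nat & nat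
| Get of nat & nat
| Put of nat & nat
| Read of nat & nat
| Seq of cmd & cmd
| When of nat & cmd
| Loop of nat & nat & cmd.

Record state := State { reg : nat -> nat; arr : nat -> nat }.

Definition setr (s : state) (x v : nat) := State (upd (reg s) x v) (arr s).
Definition seta (s : state) (k v : nat) := State (reg s) (upd (arr s) k v).

Fixpoint sem (inp : seq nat) (c : cmd) (s : state) : state :=
  match c with
  | Zero x => setr s x 0
  | Inc x => setr s x (reg s x).+1
  | Minus x y z => setr s x (reg s y - reg s z)
  | Get x y => setr s x (arr s (reg s y))
  | Put x y => seta s (reg s x) (reg s y)
  | Read x y => setr s x (nth 0 inp (reg s y))
  | Seq c1 c2 => sem inp c2 (sem inp c1 s)
  | When x c1 => if 0 < reg s x then sem inp c1 s else s
  | Loop x b c1 => iter (minn (reg s x) (reg s b)) (sem inp c1) s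
  end.

Fixpoint loop_steps (f : state -> state) (g : state -> nat) k s : nat :=
  if k is k'.+1 then (g s + loop_steps f g k' (f s)).+1 else 0.

(** The cost in elementary commands. It is refined to the logarithmic cost of
    machine instructions by [simulation]. *)
Fixpoint steps (inp : seq nat) (c : cmd) (s : state) : nat :=
  match c with
  | Seq c1 c2 => steps inp c1 s + steps inp c2 (sem inp c1 s)
  | When x c1 => (if 0 < reg s x then steps inp c1 s else 0).+1
  | Loop x b c1 =>
      (loop_steps (sem inp c1) (steps inp c1) (minn (reg s x) (reg s b)) s).+1
  | _ => 1
  end.

Fixpoint registers (c : cmd) : seq nat :=
  match c with
  | Zero x | Inc x => [:: x]
  | Minus x y z => [:: x; y; z]
  | Get x y | Put x y | Read x y => [:: x; y]
  | Seq c1 c2 => registers c1 ++ registers c2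
  | When x c1 => x :: registers c1
  | Loop x b c1 => x :: b :: registers c1
  end.

Fixpoint writes (c : cmd) : seq nat :=
  match c with
  | Zero x | Inc x | Minus x _ _ | Get x _ | Read x _ => [:: x]
  | Put _ _ => [::]
  | Seq c1 c2 => writes c1 ++ writes c2
  | When _ c1 | Loop _ _ c1 => writes c1
  end.

Fixpoint bounds (c : cmd) : seq nat :=
  match c with
  | Seq c1 c2 => bounds c1 ++ bounds c2
  | When _ c1 => bounds c1
  | Loop _ b c1 => b :: bounds c1
  | _ => [::]
  end.

Fixpoint depth (c : cmd) : nat :=
  match c with
  | Seq c1 c2 => maxn (depth c1) (depth c2)
  | When _ c1 => depth c1
  | Loop _ _ c1 => (depth c1).+1
  | _ => 0
  end.

Fixpoint csize (c : cmd) : nat :=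
  match c with
  | Seq c1 c2 => csize c1 + csize c2
  | When _ c1 | Loop _ _ c1 => (csize c1).+1
  | _ => 1
  end.

Lemma sem_frame inp c s z : z \notin writes c -> reg (sem inp c s) z = reg s z.
Proof.
elim: c s => //=.
- by move=> x s; rewrite inE /upd => /negPf ->.
- by move=> x s; rewrite inE /upd => /negPf ->.
- by move=> x y w s; rewrite inE /upd => /negPf ->.
- by move=> x y s; rewrite inE /upd => /negPf ->.
- by move=> x y s; rewrite inE /upd => /negPf ->.
- by move=> c1 IH1 c2 IH2 s; rewrite mem_cat negb_or => /andP[h1 h2]; rewrite IH2 // IH1.
- by move=> x c IH s h; case: ifP => // _; apply: IH.
- move=> x b c IH s h; elim: minn => //= k IHk; by rewrite IH.
Qed.

Definition bounded V s := (forall x, reg s x <= V) /\ (forall k, arr s k <= V).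

Lemma boundedW V V' s : V <= V' -> bounded V s -> bounded V' s.
Proof. by move=> h [h1 h2]; split=> x; [apply: leq_trans (h1 x) h|apply: leq_trans (h2 x) h]. Qed.

Lemma bounded_setr V s x v : v <= V -> bounded V s -> bounded V (setr s x v).
Proof. by move=> hv [h1 h2]; split=> //= y; rewrite /upd; case: ifP. Qed.

(** Only [Inc] and [Read] can exceed the values already present, the former by
    one and the latter by an input item. *)
Lemma bounded_sem inp c s V : (forall k, nth 0 inp k <= V) -> bounded V s ->
  bounded (V + steps inp c s) (sem inp c s).
Proof.
elim: c s V => /=.
- by move=> x s V hi hs; apply: bounded_setr => //; apply: boundedW hs; lia.
- move=> x s V hi hs; have [h1 _] := hs; apply: bounded_setr.
    by rewrite addn1 ltnS.
  by apply: boundedW hs; lia.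
- move=> x y z s V hi hs; have [h1 _] := hs; apply: bounded_setr.
    have := h1 y; lia.
  by apply: boundedW hs; lia.
- move=> x y s V hi hs; have [_ h2] := hs; apply: bounded_setr.
    have := h2 (reg s y); lia.
  by apply: boundedW hs; lia.
- move=> x y s V hi hs; have [h1 h2] := hs; split=> k /=.
    have := h1 k; lia.
  rewrite /upd; case: ifP => _; [have := h1 y; lia|have := h2 k; lia].
- move=> x y s V hi hs; apply: bounded_setr.
    have := hi (reg s y); lia.
  by apply: boundedW hs; lia.
- move=> c1 IH1 c2 IH2 s V hi hs; rewrite addnA; apply: IH2; last exact: IH1.
  by move=> k; apply: leq_trans (hi k) _; lia.
- move=> x c IH s V hi hs; case: ifP => _.
    by apply: boundedW (IH _ _ hi hs); lia.
  by apply: boundedW hs; lia.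
- move=> x b c IH s V hi hs.
  suff H k : bounded (V + loop_steps (sem inp c) (steps inp c) k s) (iter k (sem inp c) s).
    by apply: boundedW (H _); lia.
  elim: k s V hi hs => [|k IHk] s V hi hs.
    by apply: boundedW hs; lia.
  rewrite iterSr /=; apply: boundedW (IHk _ _ _ (IH _ _ hi hs)); first by lia.
  by move=> j; apply: leq_trans (hi j) _; lia.
Qed.

(** The registers that cap the loops are constant through the execution, so the
    nesting depth bounds the degree of the running time. *)
Lemma steps_static inp c B s : {in bounds c, forall b, b \notin writes c} ->
  {in bounds c, forall b, reg s b <= B} -> steps inp c s <= csize c * B.+1 ^ depth c.
Proof.
(* The registers written by the whole command are fixed for the induction, since
   a loop in one part must not be capped by a register written in another. *)
have gen (W : seq nat) d : {in bounds d, forall b, b \notin W} ->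
    {subset writes d <= W} -> forall s, {in bounds d, forall b, reg s b <= B} ->
    steps inp d s <= csize d * B.+1 ^ depth d.
  elim: d => //=.
  - move=> d1 IH1 d2 IH2 hb hw s' hs.
    have hb1 : {in bounds d1, forall b, b \notin W}.
      by move=> b h; apply: hb; rewrite mem_cat h.
    have hb2 : {in bounds d2, forall b, b \notin W}.
      by move=> b h; apply: hb; rewrite mem_cat h orbT.
    have hw1 : {subset writes d1 <= W}.
      by move=> b h; apply: hw; rewrite mem_cat h.
    have hw2 : {subset writes d2 <= W}.
      by move=> b h; apply: hw; rewrite mem_cat h orbT.
    rewrite mulnDl; apply: leq_add.
      apply: leq_trans (IH1 hb1 hw1 _ _) _.
        by move=> b h; apply: hs; rewrite mem_cat h.
      by rewrite leq_mul2l leq_pexp2l ?leq_maxl ?orbT.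
    apply: leq_trans (IH2 hb2 hw2 _ _) _.
      move=> b h; rewrite sem_frame; first by apply: hs; rewrite mem_cat h orbT.
      by apply/negP => /hw1; rewrite (negPf (hb2 _ h)).
    by rewrite leq_mul2l leq_pexp2l ?leq_maxr ?orbT.
  - move=> x d IH hb hw s' hs.
    have := IH hb hw s' hs; have := expn_gt0 B.+1 (depth d); rewrite /= => h1.
    case: ifP => _; nia.
  - move=> x b d IH hb hw s' hs.
    have hb' : {in bounds d, forall b, b \notin W}.
      by move=> c' h; apply: hb; rewrite inE h orbT.
    have key k : k <= B -> loop_steps (sem inp d) (steps inp d) k s' <=
        k * (csize d * B.+1 ^ depth d).+1.
      have : {in bounds d, forall b, reg s' b <= B}.
        by move=> c' h; apply: hs; rewrite inE h orbT.
      clear hs; elim: k s' => // k IHk s' hs hk /=.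
      have := IH hb' hw s' hs.
      have hs2 : {in bounds d, forall b, reg (sem inp d s') b <= B}.
        move=> c' h; rewrite sem_frame ?hs //.
        by apply/negP => /hw; rewrite (negPf (hb' _ h)).
      have := IHk (sem inp d s') hs2 (ltnW hk).
      by rewrite mulSn; lia.
    have hB : minn (reg s' x) (reg s' b) <= B.
      by apply: leq_trans (geq_minr _ _) _; apply: hs; rewrite inE eqxx.
    have := key _ hB; set L := loop_steps _ _ _ _ => hL.
    have := expn_gt0 B.+1 (depth d); rewrite expnS /= => h1; nia.
by move=> hb hs; apply: (gen (writes c)).
Qed.

(** * Compilation *)

(** Memory holds the registers of the source, the constant 1, the address of the
    array, a scratch cell, the loop counters (one per nesting level), and then
    the array, which is the only unbounded region. *)
Definition nregs := 32.
Definition ONE := nregs.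
Definition BASE := nregs.+1.
Definition TMP := nregs.+2.
Definition CNT := nregs.+3.

(** [pc] is the address of the first instruction, as jumps are absolute, and [d]
    is the first free loop counter. A loop is entered at its test, which is the
    last instruction. *)
Fixpoint compile (pc d : nat) (c : cmd) : seq instr :=
  match c with
  | Zero x => [:: IConst x 0]
  | Inc x => [:: IAdd x x ONE]
  | Minus x y z => [:: ISub x y z]
  | Get x y => [:: IAdd TMP BASE y; ILoad x TMP]
  | Put x y => [:: IAdd TMP BASE x; IStore TMP y]
  | Read x y => [:: IRead x y]
  | Seq c1 c2 =>
      let l := compile pc d c1 in l ++ compile (pc + size l) d c2
  | When x c1 =>
      let l := compile (pc + 2) d c1 in
      [:: IJump x (pc + 2); IJump ONE (pc + 2 + size l)] ++ l
  | Loop x b c1 =>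
      let l := compile (pc + 3) d.+1 c1 in
      [:: ISub TMP x b; ISub d x TMP; IJump ONE (pc + 3 + size l).+1] ++ l
        ++ [:: ISub d d ONE; IJump d (pc + 3)]
  end.

Definition code_at (A : seq instr) pc l :=
  forall j, j < size l -> nth IHalt A (pc + j) = nth IHalt l j.

Lemma code_at_cat A pc l1 l2 : code_at A pc (l1 ++ l2) ->
  code_at A pc l1 /\ code_at A (pc + size l1) l2.
Proof.
move=> h; split=> j hj.
  by rewrite h ?size_cat ?nth_cat ?hj // ltn_addr.
by rewrite -addnA h ?size_cat ?ltn_add2l // nth_cat ltnNge leq_addr /= addKn.
Qed.

Definition represents C (m : memory) (s : state) :=
  [/\ forall x, x < nregs -> m x = reg s x, m ONE = 1, m BASE = C
    & forall k, m (C + k) = arr s k].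

Lemma len_leq v W : v <= W -> len v <= W.+1.
Proof.
move=> h; rewrite /len ltnS; apply: leq_trans h.
case: (posnP v) => [->|v0]; first by rewrite trunc_log0.
by have /andP[h _] := trunc_log_bounds (isT : 1 < 2) v0; apply: leq_trans h; apply/ltnW/ltn_expl.
Qed.

Lemma represents_upd_reg C m s x v : nregs + 3 <= C -> x < nregs -> represents C m s ->
  represents C (upd m x v) (setr s x v).
Proof.
move=> hC hx [h1 h2 h3 h4]; split.
- by move=> y hy /=; rewrite /upd; case: ifP => // _; apply: h1.
- by rewrite /upd h2 ifN //; apply/eqP; rewrite /ONE; lia.
- by rewrite /upd h3 ifN //; apply/eqP; rewrite /BASE; lia.
- by move=> k; rewrite /= -h4 /upd ifN //; apply/eqP; lia.
Qed.

Lemma represents_upd_hidden C m s x v : TMP <= x < C -> represents C m s -> represents C (upd m x v) s.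
Proof.
move=> hx [h1 h2 h3 h4]; rewrite /TMP in hx; split.
- by move=> y hy; rewrite /upd ifN ?h1 //; apply/eqP; lia.
- by rewrite /upd h2 ifN //; apply/eqP; rewrite /ONE; lia.
- by rewrite /upd h3 ifN //; apply/eqP; rewrite /BASE; lia.
- by move=> k; rewrite -h4 /upd ifN //; apply/eqP; lia.
Qed.

Lemma represents_upd_arr C m s k v : nregs + 3 <= C -> represents C m s ->
  represents C (upd m (C + k) v) (seta s k v).
Proof.
move=> hC [h1 h2 h3 h4]; split.
- by move=> y hy /=; rewrite /upd ifN ?h1 //; apply/eqP; lia.
- by rewrite /upd h2 ifN //; apply/eqP; rewrite /ONE; lia.
- by rewrite /upd h3 ifN //; apply/eqP; rewrite /BASE; lia.
- by move=> j; rewrite /= /upd eqn_add2l h4.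
Qed.

(** In continuation form: executions are composed by adding their times, and
    [exec], which describes complete executions only, is never inverted. *)
Definition reach A inp pc m t pc' m' :=
  forall tf mf, exec A inp pc' m' tf mf -> exec A inp pc m (t + tf) mf.

Lemma reach_trans A inp pc m t pc1 m1 t' pc2 m2 :
  reach A inp pc m t pc1 m1 -> reach A inp pc1 m1 t' pc2 m2 ->
  reach A inp pc m (t + t') pc2 m2.
Proof. by move=> h1 h2 tf mf h; rewrite -addnA; apply/h1/h2. Qed.

Lemma reach_step A inp pc m ins : nth IHalt A pc = ins -> ins <> IHalt ->
  reach A inp pc m (cost inp ins m) (step inp ins pc m).1 (step inp ins pc m).2.
Proof. by move=> h1 h2 tf mf h; apply: ExecStep h. Qed.

Section Simulation.
Context (A : seq instr) (inp : seq nat) (C W : nat).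
Hypothesis hC : nregs + 3 <= C.

Let U := 2 * (C + W).+1.

(** The counters below [d] belong to the enclosing loops, so the code must
    preserve them. *)
Definition simulates pc d m (T : nat) pc' s' :=
  exists m' t, [/\ represents C m' s', forall j, CNT <= j < d -> m' j = m j, t <= T
    & reach A inp pc m t pc' m'].

Lemma simulates_trans pc d m T1 pc1 s1 T pc2 s2 :
  simulates pc d m T1 pc1 s1 ->
  (forall m1, represents C m1 s1 -> (forall j, CNT <= j < d -> m1 j = m j) ->
     exists2 T2, simulates pc1 d m1 T2 pc2 s2 & T1 + T2 <= T) ->
  simulates pc d m T pc2 s2.
Proof.
move=> [m1 [t1 [h1 h2 h3 h4]]] H.
have [T2 [m2 [t2 [k1 k2 k3 k4]]] hT] := H _ h1 h2.
exists m2, (t1 + t2); split=> //.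
- by move=> j hj; rewrite k2 ?h2.
- by apply: leq_trans hT; apply: leq_add.
- exact: reach_trans h4 k4.
Qed.

Lemma simulates_done pc d m s : represents C m s -> simulates pc d m 0 pc s.
Proof. by move=> h; exists m, 0; split. Qed.

Lemma simulates_reach pc d m t T T1 pc1 m1 pc' s' :
  reach A inp pc m t pc1 m1 -> (forall j, CNT <= j < d -> m1 j = m j) ->
  t <= T1 -> T1 <= T -> simulates pc1 d m1 (T - T1) pc' s' ->
  simulates pc d m T pc' s'.
Proof.
move=> h1 h2 h3 hT [m' [t' [k1 k2 k3 k4]]].
exists m', (t + t'); split=> //.
- by move=> j hj; rewrite k2 ?h2.
- by apply: leq_trans (leq_add h3 k3) _; rewrite subnKC.
- exact: reach_trans h1 k4.
Qed.

Lemma simulates_step pc d m ins T T1 pc' s' :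
  nth IHalt A pc = ins -> ins <> IHalt ->
  (forall j, CNT <= j < d -> (step inp ins pc m).2 j = m j) ->
  cost inp ins m <= T1 -> T1 <= T ->
  simulates (step inp ins pc m).1 d (step inp ins pc m).2 (T - T1) pc' s' ->
  simulates pc d m T pc' s'.
Proof. by move=> h1 h2; apply: simulates_reach; apply: reach_step. Qed.

Lemma simulates_leq pc d m T T' pc' s' : T <= T' ->
  simulates pc d m T pc' s' -> simulates pc d m T' pc' s'.
Proof. by move=> h [m' [t [h1 h2 h3 h4]]]; exists m', t; split=> //; apply: leq_trans h. Qed.

(** Each unit of [steps] accounts for at most four instructions, and an
    instruction costs at most [U], because its operands are at most [C + W]. *)
Lemma simulation c pc d m s V : {in registers c, forall x, x < nregs} ->
  CNT <= d -> d + depth c <= C -> code_at A pc (compile pc d c) ->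
  (forall k, nth 0 inp k <= V) -> bounded V s -> V + steps inp c s <= W ->
  represents C m s ->
  simulates pc d m (4 * U * steps inp c s) (pc + size (compile pc d c)) (sem inp c s).
Proof.
have hU v w : v <= C + W -> w <= C + W -> len v + len w <= U.
  by move=> /len_leq h1 /len_leq h2; rewrite /U; lia.
have hU1 v : v <= C + W -> len v <= U by move=> /len_leq h; rewrite /U; lia.
have hfr x v j (m' : memory) d' : x < CNT -> CNT <= j < d' -> upd m' x v j = m' j.
  by move=> hx hj; rewrite /upd ifN //; apply/eqP; lia.
have hC1 : 1 <= C + W by lia.
have hx x : x < nregs -> x < CNT by rewrite /CNT; lia.
have hT : TMP <= TMP < C by rewrite leqnn /TMP; lia.
elim: c pc d m s V => /=.
- move=> x pc d m s V hr hd hdC /(_ 0 isT) hA hi hb hW hm.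
  rewrite addn0 addn1 in hA *.
  have hx1 : x < nregs by apply: hr; rewrite inE.
  apply: (simulates_step (T1 := U) hA) => //=.
  + by move=> j hj; apply: hfr hj; apply: hx.
  + by lia.
  + by apply/(simulates_leq (leq0n _))/simulates_done/represents_upd_reg.
- move=> x pc d m s V hr hd hdC /(_ 0 isT) hA hi hb hW hm.
  rewrite addn0 addn1 in hA *.
  have hx1 : x < nregs by apply: hr; rewrite inE.
  have [r1 r2 r3 r4] := hm; have [b1 b2] := hb.
  have h1 : reg s x <= C + W by have := b1 x; lia.
  apply: (simulates_step (T1 := U) hA) => //=.
  + by move=> j hj; apply: hfr hj; apply: hx.
  + by rewrite r2 r1 // hU.
  + by lia.
  + apply/(simulates_leq (leq0n _))/simulates_done.
    by rewrite r2 addn1 r1 //; apply: represents_upd_reg.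
- move=> x y z pc d m s V hr hd hdC /(_ 0 isT) hA hi hb hW hm.
  rewrite addn0 addn1 in hA *.
  have hx1 : x < nregs by apply: hr; rewrite !inE eqxx.
  have hy : y < nregs by apply: hr; rewrite !inE eqxx orbT.
  have hz : z < nregs by apply: hr; rewrite !inE eqxx !orbT.
  have [r1 r2 r3 r4] := hm; have [b1 b2] := hb.
  have h1 : reg s y <= C + W by have := b1 y; lia.
  have h2 : reg s z <= C + W by have := b1 z; lia.
  apply: (simulates_step (T1 := U) hA) => //=.
  + by move=> j hj; apply: hfr hj; apply: hx.
  + by rewrite !r1 // hU.
  + by lia.
  + apply/(simulates_leq (leq0n _))/simulates_done.
    by rewrite !r1 //; apply: represents_upd_reg.
- move=> x y pc d m s V hr hd hdC hA hi hb hW hm.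
  have hA0 := hA 0 isT; have hA1 := hA 1 isT; rewrite addn0 addn1 /= in hA0 hA1.
  have hx1 : x < nregs by apply: hr; rewrite !inE eqxx.
  have hy : y < nregs by apply: hr; rewrite !inE eqxx orbT.
  have [r1 r2 r3 r4] := hm; have [b1 b2] := hb.
  have h1 : reg s y <= C + W by have := b1 y; lia.
  have h2 : C + reg s y <= C + W by have := b1 y; lia.
  have h3 : arr s (reg s y) <= C + W by have := b2 (reg s y); lia.
  rewrite addn2; apply: (simulates_step (T1 := U) hA0) => //=.
  + by move=> j hj; apply: hfr hj.
  + by rewrite r3 r1 // hU //; lia.
  + by lia.
  have eT : upd m TMP (m BASE + m y) TMP = C + reg s y by rewrite /upd eqxx r3 r1.
  have eA : upd m TMP (m BASE + m y) (C + reg s y) = arr s (reg s y).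
    by rewrite /upd ifN ?r4 //; apply/eqP; lia.
  apply: (simulates_step (T1 := U) hA1) => //=.
  + by move=> j hj; apply: hfr hj; apply: hx.
  + by rewrite eT eA hU.
  + by lia.
  + apply/(simulates_leq (leq0n _))/simulates_done.
    by rewrite eT eA; apply: represents_upd_reg => //; apply: represents_upd_hidden.
- move=> x y pc d m s V hr hd hdC hA hi hb hW hm.
  have hA0 := hA 0 isT; have hA1 := hA 1 isT; rewrite addn0 addn1 /= in hA0 hA1.
  have hx1 : x < nregs by apply: hr; rewrite !inE eqxx.
  have hy : y < nregs by apply: hr; rewrite !inE eqxx orbT.
  have [r1 r2 r3 r4] := hm; have [b1 b2] := hb.
  have h1 : reg s x <= C + W by have := b1 x; lia.
  have h2 : C + reg s x <= C + W by have := b1 x; lia.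
  have h3 : reg s y <= C + W by have := b1 y; lia.
  rewrite addn2; apply: (simulates_step (T1 := U) hA0) => //=.
  + by move=> j hj; apply: hfr hj.
  + by rewrite r3 r1 // hU //; lia.
  + by lia.
  have eT : upd m TMP (m BASE + m x) TMP = C + reg s x by rewrite /upd eqxx r3 r1.
  have eA : upd m TMP (m BASE + m x) y = reg s y.
    by rewrite /upd ifN ?r1 //; apply/eqP; rewrite /TMP; lia.
  apply: (simulates_step (T1 := U) hA1) => //=.
  + move=> j hj; rewrite eT /upd ifN //; last by apply/eqP; lia.
  + by rewrite eT eA hU.
  + by lia.
  + apply/(simulates_leq (leq0n _))/simulates_done.
    by rewrite eT eA; apply: represents_upd_arr => //; apply: represents_upd_hidden.
- move=> x y pc d m s V hr hd hdC /(_ 0 isT) hA hi hb hW hm.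
  rewrite addn0 addn1 in hA *.
  have hx1 : x < nregs by apply: hr; rewrite !inE eqxx.
  have hy : y < nregs by apply: hr; rewrite !inE eqxx orbT.
  have [r1 r2 r3 r4] := hm; have [b1 b2] := hb.
  have h1 : reg s y <= C + W by have := b1 y; lia.
  have h2 : nth 0 inp (reg s y) <= C + W by have := hi (reg s y); lia.
  apply: (simulates_step (T1 := U) hA) => //=.
  + by move=> j hj; apply: hfr hj; apply: hx.
  + by rewrite !r1 // hU.
  + by lia.
  + apply/(simulates_leq (leq0n _))/simulates_done.
    by rewrite !r1 //; apply: represents_upd_reg.
- move=> c1 IH1 c2 IH2 pc d m s V hr hd hdC /code_at_cat[hA1 hA2] hi hb hW hm.
  apply: (@simulates_trans pc d m (4 * U * steps inp c1 s)
            (pc + size (compile pc d c1)) (sem inp c1 s)).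
    apply: (IH1 _ _ _ _ V) => //; try by lia.
    by move=> x hx1; apply: hr; rewrite mem_cat hx1.
  move=> m1 hm1 _; exists (4 * U * steps inp c2 (sem inp c1 s)); last by lia.
  rewrite size_cat addnA; apply: (IH2 _ _ _ _ (V + steps inp c1 s)) => //.
  + by move=> x hx1; apply: hr; rewrite mem_cat hx1 orbT.
  + by lia.
  + by move=> k; apply: leq_trans (hi k) _; lia.
  + exact: bounded_sem.
  + by lia.
- move=> x c IH pc d m s V hr hd hdC hA hi hb hW hm.
  have hA0 := hA 0 isT; have hA1 := hA 1 isT; rewrite addn0 addn1 /= in hA0 hA1.
  have [_ hAc] := @code_at_cat _ _ [:: _; _] _ hA.
  have hx1 : x < nregs by apply: hr; rewrite !inE eqxx.
  have [r1 r2 r3 r4] := hm; have [b1 b2] := hb.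
  have h1 : reg s x <= C + W by have := b1 x; lia.
  apply: (simulates_step (T1 := U) hA0) => //=.
  + by rewrite r1 // hU1.
  + by lia.
  rewrite r1 //; case: ifP hW => _ hW.
    rewrite (_ : pc + (size (compile (pc + 2) d c)).+2 = (pc + 2) + size (compile (pc + 2) d c)); last by lia.
    apply: (@simulates_leq _ _ _ (4 * U * steps inp c s)); first by lia.
    apply: (IH _ _ _ _ V) => //; last by lia.
    by move=> y hy; apply: hr; rewrite inE hy orbT.
  apply: (simulates_step (T1 := U) hA1) => //=.
  + by rewrite r2 hU1.
  + by lia.
  + rewrite r2 /= (_ : pc + (size (compile (pc + 2) d c)).+2 = (pc + 2) + size (compile (pc + 2) d c)); last by lia.
    by apply/(simulates_leq (leq0n _))/simulates_done.
- move=> x b c IH pc d m s V hr hd hdC hA hi hb hW hm.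
  set l := compile (pc + 3) d.+1 c in hA *.
  have hA0 := hA 0 isT; have hA1 := hA 1 isT; have hA2 := hA 2 isT.
  rewrite addn0 addn1 addn2 /= in hA0 hA1 hA2.
  have [_ /code_at_cat[hAc hAe]] := @code_at_cat _ _ [:: _; _; _] _ hA.
  have hA3 := hAe 0 isT; have hA4 := hAe 1 isT; rewrite /= addn0 in hA3 hAc.
  rewrite /= addn1 in hA4.
  have hx1 : x < nregs by apply: hr; rewrite !inE eqxx.
  have hb1 : b < nregs by apply: hr; rewrite !inE eqxx orbT.
  have hdd : TMP <= d < C by rewrite /CNT in hd; rewrite /TMP; lia.
  have [r1 r2 r3 r4] := hm; have [b1 b2] := hb.
  have h1 : reg s x <= C + W by have := b1 x; lia.
  have h2 : reg s b <= C + W by have := b1 b; lia.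
  set m1 := upd m TMP (reg s x - reg s b).
  set k := minn (reg s x) (reg s b).
  set m2 := upd m1 d k.
  have hfd v j (m' : memory) : CNT <= j < d -> upd m' d v j = m' j.
    by move=> hj; rewrite /upd ifN //; apply/eqP; lia.
  (* From the test with counter [j], the remaining [j] iterations are performed. *)
  have loop j s' V' m' : m' d = j -> j <= W -> represents C m' s' -> bounded V' s' ->
      (forall i, nth 0 inp i <= V') ->
      V' + loop_steps (sem inp c) (steps inp c) j s' <= W ->
      simulates (pc + 3 + size l).+1 d m'
        (U + 4 * U * loop_steps (sem inp c) (steps inp c) j s')
        (pc + 3 + size l).+2 (iter j (sem inp c) s').
    elim: j s' V' m' => [|j IHj] s' V' m' hj hjW hm' hb' hi' hW'.
      apply: (simulates_step (T1 := U) hA4) => //=.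
      + by rewrite hj hU1.
      + by lia.
      + by rewrite hj /=; apply/(simulates_leq (leq0n _))/simulates_done.
    rewrite /= in hW'.
    apply: (simulates_step (T1 := U) hA4) => //=.
    + by rewrite hj hU1 //; lia.
    + by lia.
    rewrite hj /=.
    have [mc [tc [c1 c2 c3 c4]]] : simulates (pc + 3) d.+1 m'
       (4 * U * steps inp c s') (pc + 3 + size l) (sem inp c s').
      apply: (IH _ _ _ _ V') => //.
      + by move=> y hy; apply: hr; rewrite !inE hy !orbT.
      + by lia.
      + by lia.
      + by lia.
    have hdec : mc d = j.+1 by rewrite c2 // hd /=.
    apply: (simulates_reach c4 _ c3) => //; [by move=> i hi1; apply: c2; lia|by lia|].
    apply: (simulates_step (T1 := U) hA3) => //=.
    + by move=> i; apply: hfd.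
    + have [_ -> _ _] := c1; rewrite hdec hU //; lia.
    + by lia.
    rewrite -iterS iterSr.
    apply: (@simulates_leq _ _ _ (U + 4 * U * loop_steps (sem inp c) (steps inp c) j (sem inp c s'))); first by lia.
    apply: (IHj _ (V' + steps inp c s')).
    + by have [_ -> _ _] := c1; rewrite /upd eqxx hdec subn1.
    + by lia.
    + exact: represents_upd_hidden.
    + exact: bounded_sem.
    + by move=> i; apply: leq_trans (hi' i) _; lia.
    + by lia.
  apply: (simulates_step (T1 := U) hA0) => //=.
  + by move=> j hj; apply: hfr hj.
  + by rewrite !r1 // hU.
  + by lia.
  rewrite !r1 //.
  have e1 : m1 x - m1 TMP = k.
    by rewrite /m1 /upd eqxx ifN ?r1 /k; [lia| |apply/eqP; rewrite /TMP; lia].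
  apply: (simulates_step (T1 := U) hA1) => //=.
  + by move=> j; apply: hfd.
  + rewrite /m1 /upd eqxx ifN ?r1 //; last by apply/eqP; rewrite /TMP; lia.
    by rewrite hU //; lia.
  + by lia.
  rewrite -/m1 e1 -/m2.
  have hm1 : represents C m1 s by apply: represents_upd_hidden.
  have hm2 : represents C m2 s by apply: represents_upd_hidden.
  apply: (simulates_step (T1 := U) hA2) => //=.
  + by have [_ -> _ _] := hm2; rewrite hU1.
  + by lia.
  have [_ -> _ _] := hm2; rewrite /= size_cat /= -/k.
  rewrite (_ : pc + (size l + 2).+3 = (pc + 3 + size l).+2); last by lia.
  apply: (simulates_leq _ (loop k s V m2 _ _ hm2 hb hi _)); rewrite /k.
  + by rewrite -/k; lia.
  + by rewrite /m2 /upd eqxx.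
  + by have := b1 x; lia.
  + by rewrite -/k in hW *; lia.
Qed.

End Simulation.

Definition array_base c := CNT + depth c.

Definition program c : seq instr :=
  [:: IConst ONE 1; IConst BASE (array_base c)] ++ compile 2 CNT c.

Definition state0 := State (fun=> 0) (fun=> 0).

Lemma program_exec c inp V : {in registers c, forall x, x < nregs} ->
  (forall k, nth 0 inp k <= V) ->
  let N := steps inp c state0 in
  exists t m, [/\ exec (program c) inp 0 (fun=> 0) t m,
    forall x, x < nregs -> m x = reg (sem inp c state0) x
    & t <= array_base c + 4 + 8 * (array_base c + V + N).+1 * N].
Proof.
move=> hr hi N; set C := array_base c.
have hC : nregs + 3 <= C by rewrite /C /array_base /CNT; lia.
set m0 : memory := upd (upd (fun=> 0) ONE 1) BASE C.
have hm0 : represents C m0 state0.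
  split=> [x hx|||k]; rewrite /m0 /upd.
  - by rewrite !ifN //; apply/eqP; rewrite /ONE /BASE; lia.
  - by rewrite eqxx; case: eqP => //; rewrite /ONE /BASE; lia.
  - by rewrite eqxx.
  - by do 2 (case: eqP => [|_]; first by rewrite /ONE /BASE; lia).
have hA : code_at (program c) 2 (compile 2 CNT c) by [].
have hb : bounded V state0 by [].
have [m [t [[h1 h2 h3 h4] _ ht hreach]]] :=
  simulation (A := program c) (V := V) (W := V + N) hC hr (leqnn CNT)
    (leqnn C) hA hi hb (leqnn _) hm0.
have hend : exec (program c) inp (2 + size (compile 2 CNT c)) m 1 m.
  by apply: ExecHalt; rewrite nth_default // size_cat.
exists (len 1 + (len C + (t + 1))), m; split=> //.
  apply: (@ExecStep _ _ _ _ _ _ (IConst ONE 1)) => //=.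
  apply: (@ExecStep _ _ _ _ _ _ (IConst BASE C)) => //=.
  exact: hreach.
have := len_leq (leqnn C); have : len 1 = 1 by [].
by move: ht; rewrite -/N; nia.
Qed.

(** * Arithmetic by counting *)

Fixpoint block c cs := if cs is c' :: cs' then Seq c (block c' cs') else c.

Definition addprod z b xs := foldr (fun x c => Loop x b c) (Inc z) xs.

(** Sets [z] to a sum of products of registers; the empty product is the
    constant 1. *)
Definition setpoly z b xss :=
  foldl (fun c xs => Seq c (addprod z b xs)) (Zero z) xss.

Definition prodval (f : nat -> nat) (xs : seq nat) := foldr (fun x v => f x * v) 1 xs.

Definition polyval (f : nat -> nat) (xss : seq (seq nat)) :=
  foldl (fun v xs => v + prodval f xs) 0 xss.

Lemma prodval_upd f z v xs (p : pred nat) : all (fun x => (x != z) && p x) xs ->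
  prodval (upd f z v) xs = prodval f xs.
Proof.
by elim: xs => //= x xs IH /andP[/andP[xz _] h]; rewrite IH // /upd (negPf xz).
Qed.

Lemma upd_twice (m : memory) x u v : upd (upd m x u) x v = upd m x v.
Proof. by apply: functional_extensionality => y; rewrite /upd; case: eqP. Qed.

Lemma upd_id (m : memory) x : upd m x (m x) = m.
Proof. by apply: functional_extensionality => y; rewrite /upd; case: eqP => // ->. Qed.

Lemma sem_addprod inp z b xs s :
  z != b -> all (fun x => (x != z) && (reg s x <= reg s b)) xs ->
  sem inp (addprod z b xs) s =
  setr s z (reg s z + prodval (reg s) xs).
Proof.
move=> zb; elim: xs s => [|x xs IH] s /=; first by rewrite addn1.
move=> /andP[/andP[xz xb] hxs]; rewrite (minn_idPl xb).
elim: (reg s x) => [|k IHk] /=; first by rewrite mul0n addn0 /setr upd_id; case: s {IH xb hxs}.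
rewrite IHk IH; last first.
  apply: sub_all hxs => y /andP[yz yb]; rewrite yz /= /upd (negPf yz).
  by rewrite ifN 1?eq_sym.
rewrite /setr /= upd_twice {2}/upd eqxx mulSn; congr State; congr upd.
by rewrite (prodval_upd _ _ hxs) -addnA [k * _ + _]addnC.
Qed.

Lemma sem_setpoly inp z b xss s :
  (z != b) && all (fun x => (x != z) && (reg s x <= reg s b)) (flatten xss) ->
  sem inp (setpoly z b xss) s = setr s z (polyval (reg s) xss).
Proof.
move=> /andP[zb]; rewrite /setpoly /polyval; elim/last_ind: xss => //= xss xs IH.
rewrite flatten_rcons all_cat => /andP[h1 h2].
rewrite !foldl_rcons /= IH // sem_addprod //; last first.
  apply: sub_all h2 => x /andP[xz xb]; rewrite xz /= /upd (negPf xz).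
  by rewrite ifN 1?eq_sym.
rewrite /setr /= upd_twice {2}/upd eqxx; congr State; congr (upd _ _ (_ + _)).
exact: prodval_upd h2.
Qed.

Section Unfolding.
Context (inp : seq nat) (s : state).

Lemma sem_zero x : sem inp (Zero x) s = setr s x 0. Proof. by []. Qed.
Lemma sem_inc x : sem inp (Inc x) s = setr s x (reg s x).+1. Proof. by []. Qed.
Lemma sem_minus x y z : sem inp (Minus x y z) s = setr s x (reg s y - reg s z).
Proof. by []. Qed.
Lemma sem_get x y : sem inp (Get x y) s = setr s x (arr s (reg s y)). Proof. by []. Qed.
Lemma sem_put x y : sem inp (Put x y) s = seta s (reg s x) (reg s y). Proof. by []. Qed.
Lemma sem_read x y : sem inp (Read x y) s = setr s x (nth 0 inp (reg s y)).
Proof. by []. Qed.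
Lemma sem_seq c1 c2 : sem inp (Seq c1 c2) s = sem inp c2 (sem inp c1 s).
Proof. by []. Qed.
Lemma sem_when x c : sem inp (When x c) s = if 0 < reg s x then sem inp c s else s.
Proof. by []. Qed.
Lemma sem_loop x b c :
  sem inp (Loop x b c) s = iter (minn (reg s x) (reg s b)) (sem inp c) s.
Proof. by []. Qed.

End Unfolding.

Definition semE := (sem_zero, sem_inc, sem_minus, sem_get, sem_put, sem_read,
  sem_seq, sem_when, sem_loop).

Arguments sem : simpl never.
Arguments setpoly : simpl never.

(** * The program *)

(** [rp / rq] is the current fraction. The registers [rn], [rb], [rcap], [re],
    [rM] and [rone] hold the number [n] of vertices, [b = n + 1], the cap
    [b ^ 18] of all the loops of the walk, the thresholds [b ^ 3] and [b ^ 6],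
    and 1. Then come the load [rP] per vertex, the capacity [rQ], the current
    source and vertices [ri], [rx], [ry], the total load [rL], and registers
    for addresses and intermediate values. *)
Notation rp := 0 (only parsing).
Notation rq := 1 (only parsing).
Notation rn := 2 (only parsing).
Notation rb := 3 (only parsing).
Notation rcap := 4 (only parsing).
Notation re := 5 (only parsing).
Notation rM := 6 (only parsing).
Notation rP := 7 (only parsing).
Notation rQ := 8 (only parsing).
Notation rone := 9 (only parsing).
Notation ri := 10 (only parsing).
Notation rx := 11 (only parsing).
Notation ry := 12 (only parsing).
Notation rL := 13 (only parsing).
Notation rxy := 14 (only parsing).
Notation ryx := 15 (only parsing).
Notation rxx := 16 (only parsing).
Notation ryy := 17 (only parsing).
Notation rr := 18 (only parsing).
Notation rlx := 19 (only parsing).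
Notation rly := 20 (only parsing).
Notation rg := 21 (only parsing).
Notation rt := 22 (only parsing).
Notation rs := 23 (only parsing).

(** [x] runs over the ranks of the vertices. *)
Definition for_ x c := Seq (Zero x) (Loop rn rcap (Seq c (Inc x))).
Definition for3 c := for_ ri (for_ rx (for_ ry c)).

(** The array is indexed by triples: for the source [i], the cell [(i, x, y)]
    holds the residual capacity from [x] to [y]. As there are no loops, the
    diagonal cell [(i, x, x)] is free to hold the load of [x]. *)
Definition slot z x y := setpoly z rcap [:: [:: ri; rn; rn]; [:: x; rn]; [:: y]].
Definition read_edge z x y :=
  Seq (setpoly rt rcap [:: [::]; [:: x; rn]; [:: y]]) (Read z rt).
Definition read_scale z x :=
  Seq (setpoly rt rcap [:: [::]; [:: rn; rn]; [:: ri; rn]; [:: x]]) (Read z rt).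

(** The capacity is written first, so that on the diagonal the load prevails. *)
Definition init_cell := block (read_edge rs rx ry) [::
  read_edge rg ry rx; setpoly rr rcap [:: [:: rQ; rs]; [:: rQ; rg]];
  slot rxy rx ry; Put rxy rr;
  read_scale rs rx; setpoly rr rcap [:: [:: rP; rs]];
  slot rxx rx rx; Put rxx rr].

(** The unit moves when the residual capacity [rr] and the truncated difference
    [rg] of [lx] and [ly + 1] are positive. *)
Definition push_cell := block (slot rxy rx ry) [::
  slot ryx ry rx; slot rxx rx rx; slot ryy ry ry;
  Get rr rxy; Get rlx rxx; Get rly ryy; Inc rly; Minus rg rlx rly;
  When rr (When rg (block (Minus rr rr rone) [:: Put rxy rr;
    Get rt ryx; Inc rt; Put ryx rt;
    Minus rlx rlx rone; Put rxx rlx;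
    read_scale rs ry; When rs (Put ryy rly)]))].

Definition add_load := block (slot rxx rx rx) [:: Get rlx rxx; addprod rL rcap [:: rlx]].

(** [rcap] sweeps suffice, because the initial energy is smaller and each sweep
    decreases it unless the state is balanced. The last two tests turn the thresholds into
    truncated subtractions. *)
Definition walk_step := block (setpoly rQ rcap [:: [:: rM; rq]]) [::
  setpoly rP rcap [:: [:: rM; rp]; [:: re]];
  for3 init_cell;
  Loop rcap rcap (for3 push_cell);
  Zero rL; for_ ri (for_ rx add_load);
  Minus rg rM rL; Minus rg rone rg; When rg (Inc rq);
  Minus rg re rL; When rg (Inc rp)].

(** The program is cut into stages in which the caps of the loops are not
    written, as [steps_static] requires. *)
Definition set_one := block (Read rn rt) [:: Zero rone; Inc rone; Inc rq].
Definition set_base := setpoly rb rn [:: [:: rn]; [::]].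
(** The exponents 3 and 6 are those of the thresholds. The load per vertex is then
    at most [b ^ 6 * n ^ 2 + b ^ 3 <= b ^ 8], so the initial energy is less than
    [b ^ 2 * (b ^ 8) ^ 2 = b ^ 18]. *)
Definition set_params := block (setpoly rcap rb [:: nseq 18 rb]) [::
  setpoly re rb [:: nseq 3 rb]; setpoly rM rb [:: nseq 6 rb]].
Definition walk := Loop rcap rcap walk_step.
Definition cheeger_cmd := block set_one [:: set_base; set_params; walk].

Lemma registers_small : {in registers cheeger_cmd, forall x, x < nregs}.
Proof. by apply/allP; vm_compute. Qed.

(** * Loops over the vertices *)

Section Folds.
Context (V : finType) (inp : seq nat) (X : Type) (abs : state -> X).
Let n := #|V|.

Definition rank (u : V) := index u (enum V).

Lemma rank_lt u : rank u < n.
Proof. by rewrite /n cardE index_mem mem_enum. Qed.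

Lemma rank_inj : injective rank.
Proof. by move=> u v; apply: (index_inj u); rewrite mem_enum. Qed.

(** [abs] is the part of the state that matters, for instance the array. The
    body may use scratch registers, but it sees the registers that it does not
    write as they were before the loop. *)
Lemma for_fold (F : V -> X -> X) x c s :
  [&& x \notin [:: rn; rcap], rn \notin writes c, rcap \notin writes c & x \notin writes c] ->
  (forall s v, abs (setr s x v) = abs s) ->
  reg s rn = n -> n <= reg s rcap ->
  (forall u s', (forall z, z \notin x :: writes c -> reg s' z = reg s z) ->
     reg s' x = rank u -> abs (sem inp c s') = F u (abs s')) ->
  abs (sem inp (for_ x c) s) = foldl (fun a u => F u a) (abs s) (enum V).
Proof.
rewrite !inE negb_or => /and4P[/andP[xn xc] hn hc hx] habs sn sc H.
rewrite /for_ sem_seq sem_zero sem_loop /= /upd !ifN 1?eq_sym //.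
rewrite sn (minn_idPl sc); set body := sem inp _; set s1 := setr s x 0.
have inv k : k <= n -> let s2 := iter k body s1 in
    [/\ forall z, z \notin x :: writes c -> reg s2 z = reg s z, reg s2 x = k
      & abs s2 = foldl (fun a u => F u a) (abs s) (take k (enum V))].
  elim: k => [_|k IHk hk] /=.
    split; last by rewrite take0 habs.
      by move=> z; rewrite inE negb_or /upd => /andP[/negPf -> _].
    by rewrite /upd eqxx.
  have [h1 h2 h3] := IHk (ltnW hk); set s2 := iter k body s1 in h1 h2 h3 *.
  have [u0 _] : exists u0 : V, true by apply/card_gt0P; exact: leq_trans hk.
  set u := nth u0 (enum V) k.
  have hu : rank u = k by rewrite /rank index_uniq ?enum_uniq // -cardE.
  have Hu := H u s2 h1; rewrite hu in Hu; have {}Hu := Hu h2.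
  split.
  - move=> z hz; rewrite /upd; move: hz; rewrite inE negb_or => /andP[zx zc].
    by rewrite (negPf zx) sem_frame // h1 // inE negb_or zx.
  - by rewrite /upd eqxx sem_frame // h2.
  - by rewrite /body !semE habs Hu h3 (take_nth u0) -?cardE // foldl_rcons.
have [_ _] := inv n (leqnn n).
by rewrite take_oversize // /n cardE.
Qed.

Lemma foldl_allpairs (R S T : Type) (Z : Type) (g : Z -> T -> Z) (f : R -> S -> T) z xs ys :
  foldl g z [seq f x y | x <- xs, y <- ys] =
  foldl (fun z x => foldl (fun z y => g z (f x y)) z ys) z xs.
Proof.
elim: xs z => //= x xs IH z; rewrite foldl_cat IH; congr foldl.
by elim: ys z {IH} => //= y ys IHy z.
Qed.

Definition cells : seq (V * V * V) :=
  [seq (ix, y) | ix <- [seq (i, x) | i <- enum V, x <- enum V], y <- enum V].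

Lemma mem_cells t : t \in cells.
Proof.
case: t => -[i x] y; apply/allpairsP; exists ((i, x), y); rewrite mem_enum; split=> //.
by apply/allpairsP; exists (i, x); rewrite !mem_enum.
Qed.

Lemma for3_fold (F : V * V * V -> X -> X) c s :
  all (fun z => z \notin writes c) [:: rn; rcap; ri; rx; ry] ->
  (forall s z v, z \in [:: ri; rx; ry] -> abs (setr s z v) = abs s) ->
  reg s rn = n -> n <= reg s rcap ->
  (forall i x y s', (forall z, z \notin [:: ri, rx, ry & writes c] -> reg s' z = reg s z) ->
     reg s' ri = rank i -> reg s' rx = rank x -> reg s' ry = rank y ->
     abs (sem inp c s') = F (i, x, y) (abs s')) ->
  abs (sem inp (for3 c) s) = foldl (fun a t => F t a) (abs s) cells.
Proof.
move=> /= /and5P[wn wc wi wx]; rewrite andbT => wy habs sn sc H.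
rewrite /cells !foldl_allpairs.
have eW x : writes (for_ x c) = x :: (writes c ++ [:: x]) by [].
have eW2 : writes (for_ rx (for_ ry c)) = rx :: (ry :: writes c ++ [:: ry]) ++ [:: rx] by [].
have mc z : z \notin writes c -> z != ry -> z \notin writes (for_ ry c).
  by move=> h1 h2; rewrite eW !inE mem_cat !inE !negb_or h1 h2.
have mc2 z : z \notin writes c -> z != ry -> z != rx -> z \notin writes (for_ rx (for_ ry c)).
  by move=> h1 h2 h3; rewrite eW2 !(inE, mem_cat) !negb_or h1 h2 h3.
rewrite /for3; refine (for_fold (F := fun i a => foldl (fun a x =>
  foldl (fun a y => F (i, x, y) a) a (enum V)) a (enum V)) _ _ sn sc _).
- by rewrite !mc2.
- by move=> s' v; rewrite habs.
move=> i s' hs' si.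
have frame' z : z \notin [:: ri, rx, ry & writes c] -> reg s' z = reg s z.
  rewrite !inE !negb_or => /and4P[h1 h2 h3 h4]; apply: hs'.
  by rewrite inE negb_or h1 mc2.
apply: (for_fold (F := fun x a => foldl (fun a y => F (i, x, y) a) a (enum V))) => //.
- by rewrite !mc.
- by move=> s2 v; rewrite habs.
- by rewrite frame' // !inE negb_or /= wn.
- by rewrite frame' // !inE negb_or /= wc.
move=> x s2 hs2 sx.
have frame2 z : z \notin [:: rx, ry & writes c] -> reg s2 z = reg s' z.
  rewrite !inE !negb_or => /and3P[h2 h3 h4]; apply: hs2.
  by rewrite inE negb_or h2 mc.
apply: (for_fold (F := fun y a => F (i, x, y) a)) => //.
- by rewrite wn wc wy.
- by move=> s3 v; rewrite habs.
- by rewrite frame2 ?frame' // !inE !negb_or /= wn.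
- by rewrite frame2 ?frame' // !inE !negb_or /= wc.
move=> y s3 hs3 sy; apply: H => //.
- move=> z hz; have := hz; rewrite !inE !negb_or => /and4P[h1 h2 h3 h4].
  by rewrite hs3 ?frame2 ?frame' // !inE !negb_or ?h1 ?h2 ?h3.
- by rewrite hs3 ?frame2 // !inE !negb_or.
- by rewrite hs3 // !inE !negb_or.
Qed.

End Folds.

(** * Cells *)

Lemma nth_allpairs (T1 T2 R : Type) (d : R) (x0 : T1) (y0 : T2) (f : T1 -> T2 -> R) xs ys i j :
  i < size xs -> j < size ys ->
  nth d [seq f x y | x <- xs, y <- ys] (i * size ys + j) = f (nth x0 xs i) (nth y0 ys j).
Proof.
move=> hi hj; elim: xs i hi => //= x xs IH [|i] hi.
  by rewrite nth_cat size_map mul0n add0n hj (nth_map y0).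
rewrite nth_cat size_map ifN; last by rewrite mulSn; lia.
by rewrite (_ : _ - _ = i * size ys + j) ?IH //; rewrite mulSn; lia.
Qed.

Lemma sem_seq_eq inp c1 c2 s s1 : sem inp c1 s = s1 ->
  sem inp (Seq c1 c2) s = sem inp c2 s1.
Proof. by move <-. Qed.

Section Cells.
Context (G : graph) (S : scale G).
Let n := #|G|.
Let inp := encode S.

Lemma nth_rank u0 (u : G) : nth u0 (enum G) (rank u) = u.
Proof. by rewrite nth_index // mem_enum. Qed.

Lemma nth_pairs (f : G -> G -> nat) x y :
  nth 0 [seq f x y | x <- enum G, y <- enum G] (rank x * n + rank y) = f x y.
Proof.
have hs : size (enum G) = n by rewrite -cardE.
by rewrite -{1}hs (nth_allpairs _ x x) ?nth_rank // hs rank_lt.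
Qed.

Lemma size_pairs (f : G -> G -> nat) :
  size [seq f x y | x <- enum G, y <- enum G] = n * n.
Proof. by rewrite size_allpairs -cardE. Qed.

Lemma pair_lt (x y : G) : rank x * n + rank y < n * n.
Proof. have := rank_lt x; have := rank_lt y; rewrite -/n; nia. Qed.

Lemma encode_edge x y : nth 0 inp (rank x * n + rank y).+1 = ((x, y) \in edges G).
Proof.
rewrite /inp /encode /= nth_cat size_pairs pair_lt.
exact: (nth_pairs (fun x y => nat_of_bool ((x, y) \in edges G))).
Qed.

Lemma encode_scale i x : nth 0 inp (n * n + (rank i * n + rank x)).+1 = (x \in S i).
Proof.
rewrite /inp /encode /= nth_cat size_pairs ltnNge leq_addr /= addKn.
exact: (nth_pairs (fun i x => nat_of_bool (x \in S i))).
Qed.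

Lemma encode_leq k : nth 0 inp k <= n.+1.
Proof.
have [hk|hk] := ltnP k (size inp); last by rewrite nth_default.
have := mem_nth 0 hk; set v := nth _ _ _.
rewrite inE mem_cat => /or3P[/eqP -> //| |] /allpairsP[[x y] [_ _ ->]];
  by apply: leq_trans (leq_b1 _) _.
Qed.

Definition cell (t : G * G * G) := rank t.1.1 * (n * n) + rank t.1.2 * n + rank t.2.

Lemma cell_inj : injective cell.
Proof.
move=> [[i x] y] [[j u] v]; rewrite /cell /= => e.
have n0 : 0 < n by apply: leq_ltn_trans (rank_lt y).
have [hx hu hy hv] := And4 (rank_lt x) (rank_lt u) (rank_lt y) (rank_lt v).
rewrite -/n in hx hu hy hv.
have e' : (rank i * n + rank x) * n + rank y = (rank j * n + rank u) * n + rank v by lia.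
have e1 : rank i * n + rank x = rank j * n + rank u.
  by have := congr1 (divn^~ n) e'; rewrite !divnMDl // !divn_small // !addn0.
have e2 : rank y = rank v by move: e'; rewrite e1; lia.
have e3 : rank i = rank j.
  by have := congr1 (divn^~ n) e1; rewrite !divnMDl // !divn_small // !addn0.
have e4 : rank x = rank u by move: e1; rewrite e3; lia.
by rewrite (rank_inj e2) (rank_inj e3) (rank_inj e4).
Qed.

Lemma upd_cell (a : memory) t v t' : upd a (cell t) v (cell t') = if t' == t then v else a (cell t').
Proof. by rewrite /upd (inj_eq cell_inj). Qed.


(** [init] and [push] are the effects of [init_cell] and [push_cell] on the
    array. *)
Definition init P Q (t : G * G * G) (a : memory) : memory :=
  let: (i, x, y) := t in
  upd (upd a (cell (i, x, y)) (Q * edge_weight x y)) (cell (i, x, x)) (P * (x \in S i)).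

Definition push (t : G * G * G) (a : memory) : memory :=
  let: (i, x, y) := t in
  let xy := cell (i, x, y) in let yx := cell (i, y, x) in
  let xx := cell (i, x, x) in let yy := cell (i, y, y) in
  if (0 < a xy) && ((a yy).+1 < a xx) then
    let a1 := upd a xy (a xy).-1 in
    let a2 := upd a1 yx (a1 yx).+1 in
    let a3 := upd a2 xx (a xx).-1 in
    if y \in S i then upd a3 yy (a yy).+1 else a3
  else a.

Lemma sem_slot s z u v (i x y : G) : z \notin [:: rcap; ri; rn; u; v] ->
  reg s rn = n -> n < reg s rcap -> reg s ri = rank i -> reg s u = rank x ->
  reg s v = rank y -> sem inp (slot z u v) s = setr s z (cell (i, x, y)).
Proof.
rewrite !inE !negb_or => /and5P[z1 z2 z3 z4 z5] hn hcap hi hx hy.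
have [ri_ rx_ ry_] := And3 (rank_lt i) (rank_lt x) (rank_lt y).
rewrite -/n in ri_ rx_ ry_.
rewrite /slot sem_setpoly /polyval /= ?hn ?hi ?hx ?hy.
  by congr setr; rewrite /cell /=; lia.
by rewrite z1 /= !(eq_sym _ z) z2 z3 z4 z5 /= andbT; lia.
Qed.

Lemma sem_read_edge s z u v (x y : G) : rt \notin [:: rcap; rn; u; v] ->
  reg s rn = n -> n < reg s rcap -> reg s u = rank x -> reg s v = rank y ->
  exists w, sem inp (read_edge z u v) s = setr (setr s rt w) z ((x, y) \in edges G).
Proof.
rewrite !inE !negb_or => /and4P[z1 z2 z3 z4] hn hcap hx hy.
have [rx_ ry_] := conj (rank_lt x) (rank_lt y); rewrite -/n in rx_ ry_.
exists (rank x * n + rank y).+1.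
rewrite /read_edge sem_seq sem_read sem_setpoly /polyval /= ?hn ?hx ?hy.
  rewrite -[in RHS]encode_edge; congr setr; last by congr nth; rewrite /upd /=; lia.
  by congr setr; lia.
by rewrite !(eq_sym _ rt) z3 z4 /= andbT; lia.
Qed.

Lemma sem_read_scale s z v (i x : G) : rt \notin [:: rcap; rn; v] ->
  reg s rn = n -> n < reg s rcap -> reg s ri = rank i -> reg s v = rank x ->
  exists w, sem inp (read_scale z v) s = setr (setr s rt w) z (x \in S i).
Proof.
rewrite !inE !negb_or => /and3P[z1 z2 z3] hn hcap hi hx.
have [ri_ rx_] := conj (rank_lt i) (rank_lt x); rewrite -/n in ri_ rx_.
exists (n * n + (rank i * n + rank x)).+1.
rewrite /read_scale sem_seq sem_read sem_setpoly /polyval /= ?hn ?hx ?hi.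
  rewrite -[in RHS]encode_scale; congr setr; last by congr nth; rewrite /upd /=; lia.
  by congr setr; lia.
by rewrite !(eq_sym _ rt) z3 /= andbT; lia.
Qed.

Section Semantics.
Context (s : state) (i x y : G).
Hypotheses (hn : reg s rn = n) (hcap : n < reg s rcap).
Hypotheses (hi : reg s ri = rank i) (hx : reg s rx = rank x) (hy : reg s ry = rank y).

Lemma sem_init_cell : reg s rP <= reg s rcap -> reg s rQ <= reg s rcap ->
  arr (sem inp init_cell s) = init (reg s rP) (reg s rQ) (i, x, y) (arr s).
Proof.
move=> hP hQ; rewrite /init_cell [block _ _]/=.
have [w1 e1] := @sem_read_edge s rs rx ry x y isT hn hcap hx hy.
rewrite (sem_seq_eq _ e1); set s1 := setr _ _ _.
have [w2 e2] := @sem_read_edge s1 rg ry rx y x isT hn hcap hy hx.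
rewrite (sem_seq_eq _ e2) {e1 e2}; set s2 := setr _ _ _.
have hb (b : bool) : b <= reg s rcap by apply: leq_trans (leq_b1 _) _; lia.
have e3 : sem inp (setpoly rr rcap [:: [:: rQ; rs]; [:: rQ; rg]]) s2 =
    setr s2 rr (reg s rQ * edge_weight x y).
  rewrite sem_setpoly /=; last by rewrite hQ !hb.
  by congr setr; rewrite /polyval /prodval /upd /= !muln1 add0n -mulnDr.
rewrite (sem_seq_eq _ e3) {e3}; set s3 := setr _ _ _.
have e4 := @sem_slot s3 rxy rx ry i x y isT hn hcap hi hx hy.
rewrite (sem_seq_eq _ e4) sem_seq sem_put {e4}; set s4 := seta _ _ _.
have [w5 e5] := @sem_read_scale s4 rs rx i x isT hn hcap hi hx.
rewrite (sem_seq_eq _ e5) {e5}; set s5 := setr _ _ _.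
have e6 : sem inp (setpoly rr rcap [:: [:: rP; rs]]) s5 =
    setr s5 rr (reg s rP * (x \in S i)).
  rewrite sem_setpoly /=; last by rewrite hP !hb.
  by congr setr; rewrite /polyval /prodval /upd /= !muln1 add0n.
rewrite (sem_seq_eq _ e6) {e6}; set s6 := setr _ _ _.
have e7 := @sem_slot s6 rxx rx rx i x x isT hn hcap hi hx hx.
by rewrite (sem_seq_eq _ e7) sem_put.
Qed.

Lemma sem_push_cell : reg s rone = 1 ->
  arr (sem inp push_cell s) = push (i, x, y) (arr s).
Proof.
move=> h1; rewrite /push_cell [block _ _]/=.
have e1 := @sem_slot s rxy rx ry i x y isT hn hcap hi hx hy.
rewrite (sem_seq_eq _ e1) {e1}; set s1 := setr _ _ _.
have e2 := @sem_slot s1 ryx ry rx i y x isT hn hcap hi hy hx.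
rewrite (sem_seq_eq _ e2) {e2}; set s2 := setr _ _ _.
have e3 := @sem_slot s2 rxx rx rx i x x isT hn hcap hi hx hx.
rewrite (sem_seq_eq _ e3) {e3}; set s3 := setr _ _ _.
have e4 := @sem_slot s3 ryy ry ry i y y isT hn hcap hi hy hy.
rewrite (sem_seq_eq _ e4) {e4}; set s4 := setr _ _ _.
rewrite /push /s4 /s3 /s2 /s1.
move: (cell (i, x, y)) (cell (i, y, x)) (cell (i, x, x)) (cell (i, y, y)).
move=> kxy kyx kxx kyy {s1 s2 s3 s4}.
rewrite sem_seq sem_get sem_seq sem_get sem_seq sem_get sem_seq sem_inc.
rewrite sem_seq sem_minus !sem_when; set s5 := setr _ rg _.
have -> : reg s5 rr = arr s kxy by [].
have -> : reg s5 rg = arr s kxx - (arr s kyy).+1 by [].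
rewrite subn_gt0; case: ltnP => //= _; case: ltnP => //= _.
rewrite sem_seq sem_minus sem_seq sem_put sem_seq sem_get sem_seq sem_inc sem_seq sem_put.
rewrite sem_seq sem_minus sem_seq sem_put.
set s6 := seta _ _ _.
have [w e] := @sem_read_scale s6 rs ry i y isT hn hcap hi hy.
rewrite (sem_seq_eq _ e) sem_when; set s7 := setr _ _ _.
have -> : reg s7 rs = (y \in S i) by [].
have e6 : arr s6 = let a1 := upd (arr s) kxy (arr s kxy - reg s rone) in
    let a2 := upd a1 kyx (a1 kyx).+1 in upd a2 kxx (arr s kxx - reg s rone) by [].
rewrite h1 !subn1 /= in e6.
by rewrite lt0b; case: (y \in S i); rewrite ?sem_put -e6.
Qed.

End Semantics.
End Cells.

(** * Sweeps of the array *)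

Section Sweeps.
Context (G : graph) (S : scale G).
Let n := #|G|.
Let inp := encode S.
Let w := @edge_weight G.

Definition load (a : memory) (i x : G) := a (cell (i, x, x)).
Definition residual (a : memory) (i x y : G) := a (cell (i, x, y)).
Definition flows P Q a := forall i, flow_state w (S i) P Q (load a i) (residual a i).
Definition energy a := \sum_i \sum_x load a i x ^ 2.
Definition sweep a := foldl (fun a t => push S t a) a (cells G).
Definition start P Q a := foldl (fun a t => init S P Q t a) a (cells G).

(** A visit to [(i, x, y)] leaves the right value in its cell, and a visit to
    another triple writes this cell only if [x = y], with the right value again;
    so the order of the visits does not matter. *)
Lemma start_cell P Q a i x y : start P Q a (cell (i, x, y)) =
  if x == y then P * (x \in S i) else Q * w x y.
Proof.
pose v (t : G * G * G) := if t.1.2 == t.2 then P * (t.2 \in S t.1.1) else Q * w t.1.2 t.2.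
have vE j u : v (j, u, u) = P * (u \in S j) by rewrite /v /= eqxx.
suff H ts b t : (t \in ts) || (b (cell t) == v t) ->
    foldl (fun a t => init S P Q t a) b ts (cell t) = v t.
  by rewrite /start H ?mem_cells // /v /=; case: eqP => // ->.
elim: ts b => [|t' ts IH] b; first by move=> /eqP.
move=> h /=; apply: IH; move: h; rewrite inE -orbA orbCA => /orP[-> //|h].
apply/orP; right; move: t' h => [[j u] v'] h; rewrite /init !upd_cell.
case: (eqVneq t (j, u, u)) => [->|tn1]; first by rewrite vE.
case: (eqVneq t (j, u, v')) => [e|tn2]; last by case/orP: h => // /eqP e; rewrite e eqxx in tn2.
have uv : u != v' by apply: contraNneq tn1 => uv; rewrite e uv.
by rewrite e /v /= (negPf uv).
Qed.

Lemma start_flows P Q a : flows P Q (start P Q a).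
Proof.
move=> i; split.
- by move=> x xS; rewrite /load start_cell eqxx (negPf xS) muln0.
- move=> x y xy; rewrite /residual !start_cell (negPf xy) eq_sym (negPf xy).
  by rewrite /w edge_weight_sym addnn.
- move=> x xS; rewrite /load start_cell eqxx xS muln1; congr (_ + _).
  by apply: eq_bigr => y yx; rewrite /residual start_cell eq_sym (negPf yx).
Qed.

Lemma start_energy P Q a : energy (start P Q a) <= n * (n * P ^ 2).
Proof.
rewrite /energy /n -!sum_nat_const; apply: leq_sum => i _.
apply: leq_sum => x _; rewrite /load start_cell eqxx leq_exp2r //.
by case: (x \in S i); rewrite ?muln1 ?muln0.
Qed.

Definition active (a : memory) (t : G * G * G) :=
  let: (i, x, y) := t in (0 < residual a i x y) && ((load a i y).+1 < load a i x).

Lemma push_idle a t : ~~ active a t -> push S t a = a.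
Proof. by move: t => [[i x] y] /negPf; rewrite /active /push /residual /load => ->. Qed.

Lemma push_active a i x y : active a (i, x, y) -> let a' := push S (i, x, y) a in
  [/\ x != y, pushed (S i) (load a i) (load a' i) (residual a i) (residual a' i) x y
    & forall j u v, j != i -> a' (cell (j, u, v)) = a (cell (j, u, v))].
Proof.
move=> hact; have xy : x != y.
  by apply: contraTneq hact => ->; rewrite /active [X in _ && X]ltnNge leqnSn andbF.
have yx : y != x by rewrite eq_sym.
rewrite /active /residual /load in hact.
have E t : push S (i, x, y) a (cell t) =
    if t == (i, x, x) then (a (cell (i, x, x))).-1
    else if t == (i, y, y) then a (cell (i, y, y)) + (y \in S i)
    else if t == (i, x, y) then (a (cell (i, x, y))).-1
    else if t == (i, y, x) then (a (cell (i, y, x))).+1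
    else a (cell t).
  have yxx : ((i, y, x) == (i, x, y)) = false by rewrite !xpair_eqE (negPf yx) !andbF.
  have yxx2 : ((i, y, y) == (i, x, x)) = false by rewrite !xpair_eqE (negPf yx) !andbF.
  have yxx3 : ((i, y, y) == (i, x, y)) = false by rewrite !xpair_eqE (negPf yx) !andbF.
  have yxx4 : ((i, y, y) == (i, y, x)) = false by rewrite !xpair_eqE (negPf yx) !andbF.
  rewrite /push hact; case: (y \in S i); rewrite /= !upd_cell yxx.
    case: (eqVneq t (i, y, y)) => [->|_]; first by rewrite yxx2 addn1.
    case: (eqVneq t (i, x, x)) => // _.
    case: (eqVneq t (i, y, x)) => [->|_ //]; by rewrite yxx.
  case: (eqVneq t (i, x, x)) => // _.
  case: (eqVneq t (i, y, y)) => [->|_]; first by rewrite yxx3 yxx4 addn0.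
  by case: (eqVneq t (i, y, x)) => [->|_ //]; rewrite yxx.
split=> //; last first.
  by move=> j u v ji; rewrite E !xpair_eqE (negPf ji).
split; rewrite /load /residual.
- by rewrite E eqxx.
- by rewrite E !xpair_eqE (negPf yx) !eqxx !andbF.
- by move=> z zx zy; rewrite E !xpair_eqE (negPf zx) (negPf zy) !andbF.
split.
- by rewrite E !xpair_eqE !eqxx (negPf yx) (negPf xy) !andbF.
- by rewrite E !xpair_eqE !eqxx (negPf yx) (negPf xy) !andbF.
move=> u v uv h1 h2; rewrite E; rewrite !xpair_eqE in h1 h2 *; rewrite eqxx !andTb.
have uvz z : (u == z) && (v == z) = false.
  by apply/negP => /andP[/eqP e1 /eqP e2]; rewrite e1 e2 eqxx in uv.
by rewrite !uvz (negPf h1) (negPf h2).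
Qed.

Lemma push_other_sources a i x y j : active a (i, x, y) -> j != i ->
  load (push S (i, x, y) a) j = load a j /\ residual (push S (i, x, y) a) j = residual a j.
Proof.
move=> /push_active[_ _ h] ji.
by split; repeat (apply: functional_extensionality => ?); apply: h.
Qed.

Lemma push_flows P Q a t : flows P Q a -> flows P Q (push S t a).
Proof.
case: (boolP (active a t)) => [|/push_idle -> //].
move: t => [[i x] y] hact hf j.
have [->|ji] := eqVneq j i; last by have [-> ->] := push_other_sources hact ji.
have [xy hp _] := push_active hact.
by move: (hact) => /andP[h1 h2]; apply: pushed_flow (hf i) hp.
Qed.

Lemma push_energy a t : active a t -> energy (push S t a) < energy a.
Proof.
move: t => [[i x] y] hact; have [xy hp _] := push_active hact.
have /andP[_ h2] := hact.
rewrite /energy (bigD1 i) //= [X in _ < X](bigD1 i) //= -addSn.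
apply: leq_add; first exact: pushed_energy hp.
apply: leq_sum => j ji; have [-> _] := push_other_sources hact ji.
exact: leqnn.
Qed.

Lemma sweep_flows P Q a : flows P Q a -> flows P Q (sweep a).
Proof.
rewrite /sweep; elim: (cells G) a => //= t ts IH a h.
exact/IH/push_flows.
Qed.

Definition balanced a := forall t, ~~ active a t.

(** Without an active triple a sweep changes nothing; otherwise its first push
    decreases the energy, and no later one increases it. *)
Lemma sweep_progress a : balanced a /\ sweep a = a \/ energy (sweep a) < energy a.
Proof.
suff H ts : (forall t, t \in ts -> ~~ active a t) /\ foldl (fun a t => push S t a) a ts = a
    \/ energy (foldl (fun a t => push S t a) a ts) < energy a.
  case: (H (cells G)) => [[h1 h2]|h]; last by right.
  by left; split=> // t; apply: h1; apply: mem_cells.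
elim/last_ind: ts => [|ts t IH]; first by left.
rewrite foldl_rcons; case: IH => [[h1 h2]|h].
  rewrite h2; case: (boolP (active a t)) => ht; first by right; apply: push_energy.
  left; split; last exact: push_idle.
  by move=> t'; rewrite mem_rcons inE => /orP[/eqP -> //|/h1].
right; case: (boolP (active (foldl (fun a t => push S t a) a ts) t)) => ht.
  exact: ltn_trans (push_energy ht) h.
by rewrite push_idle.
Qed.

Lemma sweeps_progress k a :
  energy (iter k sweep a) <= energy a /\
  (balanced (iter k sweep a) \/ energy (iter k sweep a) + k <= energy a).
Proof.
elim: k => [|k [IH1 IH2]]; first by split=> //; right; rewrite addn0.
rewrite /=; case: (sweep_progress (iter k sweep a)) => [[h1 h2]|h].
  by rewrite h2; split=> //; left.
split; first by apply: leq_trans IH1; apply: ltnW.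
case: IH2 => IH2; last by right; lia.
have e : sweep (iter k sweep a) = iter k sweep a.
  move: (iter k sweep a) IH2 => c hc; rewrite /sweep.
  elim: (cells G) => //= t ts IHt.
  by rewrite push_idle.
by rewrite e ltnn in h.
Qed.

Lemma sweeps_balanced k a : energy a < k -> balanced (iter k sweep a).
Proof. by move=> h; have [_ [//|h2]] := sweeps_progress k a; lia. Qed.

Lemma sweeps_flows P Q k a : flows P Q a -> flows P Q (iter k sweep a).
Proof. by move=> h; elim: k => //= k; apply: sweep_flows. Qed.

Lemma balanced_stable a i : balanced a -> stable (load a i) (residual a i).
Proof.
move=> h x y _ hr; have := h (i, x, y).
by rewrite /active hr /= -leqNgt.
Qed.

(** Keeps the loads below the cap of the loop that adds them up. *)
Lemma load_energy a i x : load a i x <= energy a.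
Proof.
apply: leq_trans (_ : load a i x ^ 2 <= _); first by nia.
by rewrite /energy (bigD1 i) //= (bigD1 x) //= -addnA leq_addr.
Qed.

End Sweeps.

(** * One step of the walk *)

Lemma foldl_total (X V : Type) (F : V -> X * nat -> X * nat) (g : X -> V -> nat) a L us :
  (forall u L', F u (a, L') = (a, L' + g a u)) ->
  foldl (fun z u => F u z) (a, L) us = (a, L + \sum_(u <- us) g a u).
Proof.
move=> H; elim: us L => [|u us IH] L /=; first by rewrite big_nil addn0.
by rewrite H IH big_cons addnA.
Qed.

Section Walk.
Context (G : graph) (S : scale G).
Let n := #|G|.
Let inp := encode S.

Definition total_load (a : memory) := \sum_(i : G) \sum_(x : G) load a i x.

Definition loads_and_total (s : state) := (arr s, reg s rL).

Lemma sem_total s : reg s rn = n -> n < reg s rcap ->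
  (forall i x : G, load (arr s) i x <= reg s rcap) ->
  loads_and_total (sem inp (for_ ri (for_ rx add_load)) s) =
  (arr s, reg s rL + total_load (arr s)).
Proof.
move=> hn hcap hload; set K := reg s rcap.
pose F (i x : G) (z : memory * nat) := (z.1, z.2 + minn (load z.1 i x) K).
have -> : loads_and_total (sem inp (for_ ri (for_ rx add_load)) s) =
    foldl (fun z i => foldl (fun z x => F i x z) z (enum G)) (loads_and_total s) (enum G).
  apply: (for_fold (F := fun i z => foldl (fun z x => F i x z) z (enum G))) => //.
    exact: ltnW.
  move=> i s1 fr1 h1.
  apply: (for_fold (F := F i)) => //.
  - by rewrite fr1.
  - by rewrite fr1 // ltnW.
  move=> x s2 fr2 h2.
  have hn2 : reg s2 rn = n by rewrite fr2 // fr1.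
  have hcap2 : n < reg s2 rcap by rewrite fr2 // fr1.
  have hi2 : reg s2 ri = rank i by rewrite fr2.
  have e := @sem_slot G S s2 rxx rx rx i x x isT hn2 hcap2 hi2 h2 h2.
  rewrite /add_load /= (sem_seq_eq _ e) sem_seq sem_get sem_loop.
  rewrite /loads_and_total /F /load.
  have hc : reg s2 rcap = K by rewrite fr2 // fr1.
  rewrite -hc; move: (cell _) => k.
  set s3 := setr _ rlx _.
  have -> : reg s3 rlx = arr s2 k by [].
  have -> : reg s3 rcap = reg s2 rcap by [].
  have -> : arr s2 = arr s3 by [].
  have -> : reg s2 rL = reg s3 rL by [].
  move: (minn _ _) => j; elim: j => [|j IHj]; first by rewrite addn0.
  rewrite iterS /=; move: IHj; set s4 := iter _ _ _ => -[e1 e2].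
  by rewrite e1; move: e2; rewrite /upd /= => ->; rewrite addnS.
rewrite (foldl_total (g := fun a i => \sum_(x <- enum G) minn (load a i x) K)).
  congr (_, _ + _); rewrite /total_load big_enum /=; apply: eq_bigr => i _.
  by rewrite big_enum /=; apply: eq_bigr => x _; apply/minn_idPl/hload.
by move=> i L'; rewrite (foldl_total (g := fun a x => minn (load a i x) K)).
Qed.

Let b := n.+1.

Definition params_ok (s : state) :=
  [/\ reg s rn = n, reg s rcap = b ^ 18, reg s re = b ^ 3, reg s rM = b ^ 6 & reg s rone = 1].

Lemma params_frame c s : all (fun z => z \notin writes c) [:: rn; rcap; re; rM; rone] ->
  params_ok s -> params_ok (sem inp c s).
Proof.
by move=> /= /and5P[h1 h2 h3 h4]; rewrite andbT => h5 [p1 p2 p3 p4 p5]; split; rewrite sem_frame.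
Qed.

Lemma sem_init s : params_ok s -> reg s rP <= reg s rcap -> reg s rQ <= reg s rcap ->
  arr (sem inp (for3 init_cell) s) = start S (reg s rP) (reg s rQ) (arr s).
Proof.
move=> [hn hcap _ _ _]; rewrite hcap => hP hQ; have hb : n < b ^ 18.
  by apply: leq_trans (leq_pexp2l _ _ : b ^ 1 <= _) => //; rewrite expn1.
apply: (for3_fold (abs := arr) (F := init S (reg s rP) (reg s rQ))) => //.
  by rewrite hcap ltnW.
move=> i x y s1 fr hi hx hy.
have hc1 : reg s1 rcap = b ^ 18 by rewrite fr.
have hn1 : reg s1 rn = n by rewrite fr.
by rewrite (@sem_init_cell G S s1 i x y) ?hc1 // ?(fr rP) ?(fr rQ).
Qed.

Lemma sem_sweep s : params_ok s ->
  arr (sem inp (for3 push_cell) s) = sweep S (arr s).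
Proof.
move=> [hn hcap _ _ hone]; have hb : n < b ^ 18.
  by apply: leq_trans (leq_pexp2l _ _ : b ^ 1 <= _) => //; rewrite expn1.
apply: (for3_fold (abs := arr) (F := push S)) => //.
  by rewrite hcap ltnW.
move=> i x y s1 fr hi hx hy.
have hc1 : reg s1 rcap = b ^ 18 by rewrite fr.
have hn1 : reg s1 rn = n by rewrite fr.
by rewrite (@sem_push_cell G S s1 i x y) ?hc1 // fr.
Qed.

Lemma sem_sweeps s k : params_ok s -> let s' := iter k (sem inp (for3 push_cell)) s in
  params_ok s' /\ arr s' = iter k (sweep S) (arr s).
Proof.
move=> h; elim: k => //= k [IH1 IH2]; split; first exact: params_frame.
by rewrite sem_sweep // IH2.
Qed.

Lemma sem_walk_step s (p := reg s rp) (q := reg s rq) :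
  0 < n -> params_ok s -> p <= n * n -> q <= n ->
  exists a, [/\ flows S (b ^ 6 * p + b ^ 3) (b ^ 6 * q) a, balanced G a
    & let s' := sem inp walk_step s in
      [/\ params_ok s', reg s' rp = p + (total_load a < b ^ 3)
        & reg s' rq = q + (b ^ 6 <= total_load a)]].
Proof.
move=> n0 hs hp hq; have [hn hcap he hM hone] := hs.
set P := b ^ 6 * p + b ^ 3; set Q := b ^ 6 * q.
have hb : n < b ^ 18.
  by apply: leq_trans (leq_pexp2l _ _ : b ^ 1 <= _) => //; rewrite expn1.
have pw j : j <= 18 -> b ^ j <= b ^ 18 by move=> hj; apply: leq_pexp2l.
(* These bounds ensure that no loop below is cut short by its cap. *)
have hP8 : P <= b ^ 8.
  rewrite /P (_ : 8 = 6 + 2) // expnD.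
  have : b ^ 3 <= b ^ 6 by apply: leq_pexp2l.
  have : p.+1 <= b ^ 2 by rewrite /b; nia.
  by move=> h1 h2; apply: leq_trans (_ : b ^ 6 * p.+1 <= _); [rewrite mulnS; lia|rewrite leq_mul2l h1 orbT].
have hQ7 : Q <= b ^ 7.
  by rewrite /Q (_ : 7 = 6 + 1) // expnD leq_mul2l expn1 ltnW ?orbT.
have hP : P <= b ^ 18 by apply: leq_trans hP8 (pw _ _).
have hQ : Q <= b ^ 18 by apply: leq_trans hQ7 (pw _ _).
have hbp : p <= b ^ 18 by apply: leq_trans (pw 2 isT); rewrite /b; nia.
have hbq : q <= b ^ 18 by apply: leq_trans hq (ltnW hb).
pose a0 := start S P Q (arr s).
have a0_energy : energy G a0 < b ^ 18.
  apply: leq_ltn_trans (start_energy S P Q (arr s)) _.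
  have : P ^ 2 <= b ^ 16 by rewrite (_ : 16 = 8 * 2) // expnM leq_exp2r.
  rewrite (_ : 18 = 16 + 2) // expnD -/n.
  have : 0 < b ^ 16 by rewrite expn_gt0.
  move: (b ^ 16) (P ^ 2) => X Y X0 YX.
  have : n * (n * Y) <= n * (n * X) by rewrite !leq_mul2l YX !orbT.
  rewrite /b; clearbody n; clear - X0; nia.
pose a := iter (b ^ 18) (sweep S) a0; exists a; split.
- exact/sweeps_flows/start_flows.
- exact: sweeps_balanced.
have a_load (i x : G) : load a i x <= b ^ 18.
  apply: leq_trans (load_energy a i x) _; apply: ltnW; apply: leq_ltn_trans a0_energy.
  by have [h _] := sweeps_progress S (b ^ 18) a0; exact: h.
rewrite /walk_step /block.
have e1 : sem inp (setpoly rQ rcap [:: [:: rM; rq]]) s = setr s rQ Q.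
  rewrite sem_setpoly /=; last by rewrite hM hcap pw // hbq.
  by rewrite /polyval /= hM muln1 add0n.
rewrite (sem_seq_eq _ e1); set s1 := setr _ _ _.
have e2 : sem inp (setpoly rP rcap [:: [:: rM; rp]; [:: re]]) s1 = setr s1 rP P.
  rewrite sem_setpoly /=; last first.
    by rewrite /upd /= hM hcap he !pw // hbp.
  by rewrite /polyval /prodval /= /upd /= hM he !muln1 add0n.
rewrite (sem_seq_eq _ e2); set s2 := setr _ _ _.
have hs2 : params_ok s2 by [].
have p2 : reg s2 rp = p by [].
have q2 : reg s2 rq = q by [].
have P2 : reg s2 rP = P by [].
have Q2 : reg s2 rQ = Q by [].
have A2 : arr s2 = arr s by [].
clearbody s2; clear s1 e1 e2.
have e3 : arr (sem inp (for3 init_cell) s2) = a0.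
  by have [_ c2 _ _ _] := hs2; rewrite sem_init // ?P2 ?Q2 ?A2 // c2.
have hs3 := @params_frame (for3 init_cell) s2 isT hs2.
have p3 := @sem_frame inp (for3 init_cell) s2 rp isT.
have q3 := @sem_frame inp (for3 init_cell) s2 rq isT.
rewrite sem_seq; move: (sem inp (for3 init_cell) s2) e3 hs3 p3 q3 => s3 e3 hs3 p3 q3.
have [hs4] := sem_sweeps (b ^ 18) hs3.
have p4 := @sem_frame inp (Loop rcap rcap (for3 push_cell)) s3 rp isT.
have q4 := @sem_frame inp (Loop rcap rcap (for3 push_cell)) s3 rq isT.
have [_ c3 _ _ _] := hs3.
rewrite sem_seq; rewrite sem_loop c3 minnn in p4 q4 *.
move: (iter _ _ _) hs4 p4 q4 => s4 hs4 p4 q4 e4.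
rewrite sem_seq sem_zero; set s5 := setr s4 rL 0.
have hs5 : params_ok s5 by [].
have [n5 c5 _ _ _] := hs5.
have a5 : arr s5 = a by rewrite /s5 /= e4 e3.
have h6 : loads_and_total (sem inp (for_ ri (for_ rx add_load)) s5) = (a, total_load a).
  by rewrite sem_total // ?a5 // c5.
have hs6 := @params_frame (for_ ri (for_ rx add_load)) s5 isT hs5.
have p6 := @sem_frame inp (for_ ri (for_ rx add_load)) s5 rp isT.
have q6 := @sem_frame inp (for_ ri (for_ rx add_load)) s5 rq isT.
rewrite sem_seq.
move: (sem inp (for_ ri (for_ rx add_load)) s5) h6 hs6 p6 q6 => s6 h6 hs6 p6 q6.
have L6 : reg s6 rL = total_load a by case: h6.
have {}p6 : reg s6 rp = p by rewrite p6 /= -p2 -p3 -p4.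
have {}q6 : reg s6 rq = q by rewrite q6 /= -q2 -q3 -q4.
rewrite sem_seq sem_minus sem_seq sem_minus sem_seq sem_when sem_seq sem_minus sem_when.
have [n6 c6 E6 M6 o6] := hs6.
set s7 := setr (setr s6 rg _) rg _.
have g7 : reg s7 rg = 1 - (b ^ 6 - total_load a) by rewrite /s7 /= /upd /= o6 M6 L6.
rewrite g7 subn_gt0 ltnS leqn0 subn_eq0.
have o7 : params_ok s7 by [].
have [p7 q7 L7] : [/\ reg s7 rp = p, reg s7 rq = q & reg s7 rL = total_load a] by [].
clearbody s7; clear g7.
set s8 := if b ^ 6 <= _ then _ else _.
have [o8 [p8 q8 L8]] : params_ok s8 /\ [/\ reg s8 rp = p,
    reg s8 rq = q + (b ^ 6 <= total_load a) & reg s8 rL = total_load a].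
  rewrite /s8; case: (b ^ 6 <= _); last by rewrite addn0.
  by rewrite sem_inc addn1; split=> //; rewrite /= {1}/upd /= q7.
clearbody s8; have [_ _ E8 _ _] := o8.
rewrite [reg (setr _ _ _) _]/= {1}/upd eqxx E8 L8 subn_gt0.
case: (_ < b ^ 3); last by rewrite addn0.
by rewrite sem_inc addn1; split=> //; rewrite /= {1}/upd /= /upd /= p8.
Qed.

End Walk.

(** * The walk and the theorem *)

Section Correctness.
Context (G : graph) (S : scale G) (T0 : {set G}) (i0 : G).
Hypotheses (T0n : T0 != set0) (T0S : T0 \subset S i0).
Hypothesis hopt : forall i (T : {set G}), T \subset S i -> T != set0 ->
  #|boundary T0| * #|T| <= #|boundary T| * #|T0|.
Let n := #|G|.
Let inp := encode S.
Let num := #|boundary T0|.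
Let den := #|T0|.

Let n_gt0 : 0 < n. Proof. by apply/card_gt0P; exists i0. Qed.
Let den_gt0 : 0 < den. Proof. by rewrite card_gt0. Qed.
Let den_leq : den <= n. Proof. exact: max_card. Qed.
Let num_leq : num <= n * n.
Proof. by rewrite /n -card_prod; apply: max_card. Qed.

Definition walk_inv (s : state) :=
  [/\ params_ok G s, reg s rp <= num & 0 < reg s rq <= den].

(** If [p / q < num / den] with [q <= den] then [p < num], so that the
    incremented numerator is still at most [num]; the other case is dual. *)
Lemma walk_step_inv s (s' := sem inp walk_step s) : walk_inv s ->
  walk_inv s' /\
  if reg s rp * den == reg s rq * num then reg s' rp = reg s rp /\ reg s' rq = reg s rq
  else reg s' rp + reg s' rq = (reg s rp + reg s rq).+1.
Proof.
move=> [hs hp /andP[hq0 hq]].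
have hpn : reg s rp <= n * n by apply: leq_trans num_leq.
have hqn : reg s rq <= n by apply: leq_trans den_leq.
have [a [a1 a2 [s1 s2 s3]]] := sem_walk_step S n_gt0 hs hpn hqn.
have hst (i : G) : stable (load a i) (residual a i) by apply: balanced_stable.
have hopt' i (T : {set G}) : T \subset S i -> T != set0 ->
    cut (@edge_weight G) T0 * #|T| <= cut (@edge_weight G) T * #|T0|.
  by rewrite -!card_boundary; exact: hopt.
have he : n.+1 ^ 3 <= n.+1 ^ 6 by apply: leq_pexp2l.
rewrite -/s' in s1 s2 s3; rewrite /walk_inv.
have [lt|gt|eq] := ltngtP (reg s rp * den) (reg s rq * num).
- have := load_below a1 hst T0n T0S hopt'; rewrite -card_boundary => /(_ lt) hL.
  have hlt : reg s rp < num.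
    rewrite -(ltn_pmul2r den_gt0); apply: leq_trans lt _.
    by rewrite [leqRHS]mulnC leq_mul2r hq orbT.
  have hL' : (n.+1 ^ 6 <= total_load G a) = false.
    by apply/negbTE; rewrite -ltnNge; apply: leq_trans he.
  rewrite s2 s3 [total_load G a < _]hL hL' addn0 addn1.
  by rewrite hlt hq0 hq.
- have := load_above a1 T0n T0S; rewrite -card_boundary => /(_ gt) hL.
  have hlt : reg s rq < den.
    rewrite ltnNge; apply: contraL gt => h; rewrite -leqNgt mulnC.
    by apply: leq_mul.
  have hL' : (total_load G a < n.+1 ^ 3) = false.
    by apply/negbTE; rewrite -leqNgt; apply: leq_trans hL.
  rewrite s2 s3 [n.+1 ^ 6 <= total_load G a]hL hL' addn0 addn1.
  by rewrite hp hlt addnS.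
- have := load_equal a1 hst T0n T0S hopt'; rewrite -card_boundary => /(_ (esym eq)).
  case/andP=> h1 h2.
  have hL' : (total_load G a < n.+1 ^ 3) = false by apply/negbTE; rewrite -leqNgt.
  have hL : (n.+1 ^ 6 <= total_load G a) = false by apply/negbTE; rewrite -ltnNge.
  by rewrite s2 s3 hL hL' !addn0 hp hq0 hq.
Qed.

Lemma walk_iter_inv k s : walk_inv s -> let s' := iter k (sem inp walk_step) s in
  walk_inv s' /\ (reg s' rp * den = reg s' rq * num \/ k < reg s' rp + reg s' rq).
Proof.
move=> hs; elim: k => [|k [IH1 IH2]].
  by split=> //; right; have [_ _ /andP[h _]] := hs; rewrite addn_gt0 h orbT.
rewrite iterS; move: (iter k _ s) IH1 IH2 => s1 IH1 IH2.
have [h1 h2] := walk_step_inv IH1; split=> //.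
move: h2; case: eqP => [e [-> ->]|ne h2]; first by left.
by case: IH2 => // IH2; right; rewrite h2.
Qed.

Lemma walk_correct s (s' := sem inp walk s) :
  params_ok G s -> reg s rp = 0 -> reg s rq = 1 ->
  0 < reg s' rq /\ reg s' rp * den = reg s' rq * num.
Proof.
move=> hs hp hq; have [_ hcap _ _ _] := hs.
have hinv : walk_inv s by split=> //; rewrite ?hp ?hq.
rewrite /s' /walk sem_loop hcap minnn.
have [[_ hp' /andP[hq0 hq']] h] := walk_iter_inv (n.+1 ^ 18) hinv.
split=> //; case: h => // h.
have : n.+1 ^ 2 <= n.+1 ^ 18 by apply: leq_pexp2l.
have : num + den <= n.+1 ^ 2 by move: num_leq den_leq; rewrite -mulnn mulSn mulnS; lia.
by have := leq_trans h (leq_add hp' hq'); lia.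
Qed.

End Correctness.

Section Main.
Context (G : graph) (S : scale G).
Let n := #|G|.
Let inp := encode S.

Let s1 := sem inp set_one state0.
Let s2 := sem inp set_base s1.
Let s3 := sem inp set_params s2.

Let s1_ok : [/\ reg s1 rn = n, reg s1 rone = 1, reg s1 rp = 0 & reg s1 rq = 1].
Proof. by rewrite /s1 /set_one /block !semE. Qed.

Let s2_ok : [/\ reg s2 rn = n, reg s2 rb = n.+1, reg s2 rone = 1, reg s2 rp = 0 & reg s2 rq = 1].
Proof.
rewrite /s2 /set_base; move: s1 s1_ok => s [h1 h2 h3 h4].
rewrite sem_setpoly; last by rewrite /= leqnn.
by split=> //; rewrite /polyval /prodval /= /upd /= h1 muln1 addn1.
Qed.

Let s3_ok : [/\ params_ok G s3, reg s3 rp = 0 & reg s3 rq = 1].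
Proof.
have pow z k s : z != rb -> sem inp (setpoly z rb [:: nseq k rb]) s = setr s z (reg s rb ^ k).
  move=> hz; rewrite sem_setpoly.
    congr setr; rewrite /polyval /= add0n; elim: k => //= k IH.
    by rewrite expnS -IH.
  rewrite hz /= cats0; apply/allP => x; rewrite mem_nseq => /andP[_ /eqP ->].
  by rewrite eq_sym hz leqnn.
rewrite /s3; move: s2 s2_ok => s [h1 h2 h3 h4 h5].
have -> : sem inp set_params s = sem inp (setpoly rM rb [:: nseq 6 rb])
  (sem inp (setpoly re rb [:: nseq 3 rb]) (sem inp (setpoly rcap rb [:: nseq 18 rb]) s)) by [].
rewrite !pow //.
by rewrite /= /upd /= h2; split=> //; split.
Qed.

Lemma cheeger_cmd_split : sem inp cheeger_cmd state0 = sem inp walk s3.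
Proof. by []. Qed.

Lemma cheeger_correct (s := sem inp cheeger_cmd state0) : (exists i, S i != set0) ->
  0 < reg s rq /\ cheeger S = ((reg s rp)%:R / (reg s rq)%:R)%R.
Proof.
move=> hS; have [T0 [i0 [T0n T0S -> hopt]]] := cheeger_attained hS.
have [h1 h2 h3] := s3_ok.
have [q0 e] := walk_correct T0n T0S hopt h1 h2 h3.
rewrite /s cheeger_cmd_split; split=> //; rewrite /boundary_ratio.
apply/eqP; rewrite eqr_div ?pnatr_eq0 -?lt0n ?card_gt0 //.
by rewrite -!natrM eqr_nat e mulnC.
Qed.

(** Each stage is static with caps at most [n.+1 ^ 18]. *)
Lemma cheeger_steps :
  steps inp cheeger_cmd state0 <= csize cheeger_cmd * (n.+1 ^ 18).+1 ^ depth cheeger_cmd.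
Proof.
have [h1 _ _ _] := s1_ok; have [_ h2 _ _ _] := s2_ok; have [[_ h3 _ _ _] _ _] := s3_ok.
have -> : steps inp cheeger_cmd state0 = steps inp set_one state0 +
  (steps inp set_base s1 + (steps inp set_params s2 + steps inp walk s3)) by [].
have -> : csize cheeger_cmd = csize set_one + (csize set_base + (csize set_params + csize walk)).
  by [].
have : [&& depth set_one <= depth cheeger_cmd, depth set_base <= depth cheeger_cmd,
    depth set_params <= depth cheeger_cmd & depth walk <= depth cheeger_cmd].
  by vm_compute.
move: (depth cheeger_cmd) => D /and4P[d1 d2 d3 d4].
have hX j : n.+1 <= (n.+1 ^ j.+1) by rewrite -{1}[n.+1]expn1 leq_pexp2l.
move: (hX 17); set X := n.+1 ^ 18 => {}hX.
have stage c s z : all (fun b => b \notin writes c) (bounds c) -> all (pred1 z) (bounds c) ->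
    reg s z <= X -> depth c <= D -> steps inp c s <= csize c * X.+1 ^ D.
  move=> /allP hw /allP hb hz hd; apply: leq_trans (steps_static (B := X) inp hw _) _; last first.
    by rewrite leq_mul2l leq_pexp2l ?orbT.
  by move=> y /hb /eqP ->.
have k1 : steps inp set_one state0 <= csize set_one * X.+1 ^ D.
  by apply: (stage _ _ rn) => //; vm_compute.
have k2 : steps inp set_base s1 <= csize set_base * X.+1 ^ D.
  by apply: (stage _ _ rn) => //; rewrite h1 ltnW.
have k3 : steps inp set_params s2 <= csize set_params * X.+1 ^ D.
  by apply: (stage _ _ rb) => //; rewrite h2.
have k4 : steps inp walk s3 <= csize walk * X.+1 ^ D.
  by apply: (stage _ _ rcap) => //; rewrite h3.
by have := leq_add k1 (leq_add k2 (leq_add k3 k4)); rewrite -!mulnDl.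
Qed.

End Main.

Lemma time_polynomial (c k d : nat) : exists p : {poly nat}, forall g,
  p.[g]%R = c + 4 + 8 * (c + g.+1 + k * (g.+1 ^ 18).+1 ^ d).+1 * (k * (g.+1 ^ 18).+1 ^ d).
Proof.
have [pN eN] : exists pN : {poly nat}, forall g, pN.[g]%R = k * (g.+1 ^ 18).+1 ^ d.
  exists (k%:P * (('X + 1) ^+ 18 + 1) ^+ d)%R => g.
  by rewrite !hornerE !natrXE ?natrDE ?natrME !addn1.
exists ((c + 4)%N%:P + 8%N%:P * ((c + 2)%N%:P + 'X + pN) * pN)%R => g.
rewrite -eN hornerD !hornerM !hornerD !hornerC hornerX; move: pN.[g]%R => N.
rewrite -[LHS]/(c + 4 + 8 * (c + 2 + g + N) * N); lia.
Qed.

Local Open Scope ring_scope.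

Theorem theorem7p9 :
  exists (A : seq instr) (p : {poly nat}),
    forall (G : graph) (S : scale G), (exists i : G, S i != set0) ->
      exists2 t : nat,
        outputs A (encode S) (cheeger S) t & (t <= p.[graph_size G])%N.
Proof.
have [p hp] := time_polynomial (array_base cheeger_cmd) (csize cheeger_cmd) (depth cheeger_cmd).
exists (program cheeger_cmd), p => G S hS.
have [t [m [h1 h2 h3]]] := program_exec registers_small (@encode_leq G S).
have [q0 e] := cheeger_correct hS.
exists t; first by exists m; split=> //; rewrite !h2.
apply: leq_trans h3 _; rewrite hp; have := cheeger_steps S.
move: (steps _ _ _) (array_base _) (csize _) (depth _) => N c k d.
move=> hN.
have hg : (#|G| <= graph_size G)%N by apply: leq_addr.
have hN' : (N <= k * ((graph_size G).+1 ^ 18).+1 ^ d)%N.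
  apply: leq_trans hN _; rewrite leq_mul2l; apply/orP; right.
  case: d => // d; rewrite leq_exp2r // ltnS leq_exp2r //.
apply: leq_add => //; apply: leq_mul => //; rewrite leq_mul2l /=.
by rewrite ltnS !leq_add.
Qed.
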